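(* Let $\mathfrak g=\mathfrak{pe}(2)$ and, for $a,b\in\mathbb C$, set $J(a,b):=\mathrm{Ann}_{U(\mathfrak g)}L_{a\varepsilon_1+b\varepsilon_2}$. The connected components of the inclusion order on $\{J(a,b)\mid(a,b)\in\mathbb C\times\mathbb C\}$ are the following: (i) For each $\{a,b\}\subset\mathbb C$ with $a-b\notin\mathbb Z$, we have $J(a,b)=J(b-1,a+1)$. (ii) For each $a\in\mathbb C$, the singleton $\{J(a,a+1)\}$. (iii) For each $a\in\mathbb C$, the set $\{J(a+i,a+i),\,J(a+i,a+i+2)\mid i\in\mathbb Z\}$ is a connected component, whose Hasse diagram is the infinite zigzag in which the covering relations are exactly $$J(a+i-1,a+i+1)\subsetneq J(a+i-1,a+i-1)\quad\text{and}\quad J(a+i-1,a+i+1)\subsetneq J(a+i,a+i),\qquad i\in\mathbb Z.$$ (iv) For each $a\in\mathbb C$ and $k\in\mathbb Z_{>0}$, we have $J(a-1,a+k+1)\subsetneq J(a+k,a)$.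
   Context: The ground field is $\mathbb C$. The periplectic Lie superalgebra $\mathfrak g=\mathfrak{pe}(2)\subset\mathfrak{gl}(2|2)$ consists of the matrices $\begin{pmatrix}a&b\\ c&-a^t\end{pmatrix}$ with $b$ symmetric and $c$ skew-symmetric ($a,b,c\in\mathbb C^{2\times2}$); $\mathfrak g_{\bar0}\cong\mathfrak{gl}(2)$ is given by $b=c=0$ and $\mathfrak g_1$ by $a=c=0$. $\mathfrak h$ is the diagonal Cartan subalgebra with basis $e_{ii}=E_{ii}-E_{2+i,2+i}$ and dual basis $\varepsilon_1,\varepsilon_2$ of $\mathfrak h^\ast$. The Borel subalgebra $\mathfrak b_{\bar0}\subset\mathfrak g_{\bar0}$ corresponds to the positive even root $\varepsilon_1-\varepsilon_2$, and $\mathfrak b=\mathfrak b_{\bar0}\oplus\mathfrak g_1$. $L_\lambda$ is the unique simple quotient of the Verma module $M_\lambda=U(\mathfrak g)\otimes_{U(\mathfrak b)}\mathbb C_\lambda$, $\lambda\in\mathfrak h^\ast$. In (i) and (iv) the component consists of the ideal(s) displayed. Connected components are those of the graph on the set of ideals in which comparable ideals (under inclusion) are joined. *)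

(* Defs.v *)
From HB Require Import structures.
From mathcomp Require Import all_boot all_order all_algebra.
From mathcomp Require Import boolp classical_sets reals.
From mathcomp Require Import complex.
From mathcomp.multinomials Require Import monalg.
From Stdlib Require Import Relations.

Set Implicit Arguments.
Unset Strict Implicit.
Unset Printing Implicit Defensive.

Import GRing.Theory.

Local Open Scope classical_set_scope.
Local Open Scope ring_scope.
Local Open Scope quotient_scope.

(* [quot_mod A] is the quotient of the left module V by the submodule generated
   by A (the intersection of all submodules containing A). *)
Section QuotMod.
Context (R : pzRingType) (V : lmodType R).
Implicit Types (S A : set V).

Definition is_submod S :=
  S 0 /\ forall (a : R) (u v : V), S u -> S v -> S (a *: u + v).

Definition submod_gen A : set V := smallest is_submod A.

Lemma submod_gen_is_submod A : is_submod (submod_gen A).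
Proof.
split=> [|a u v Su Sv] S [Ssub AS]; first exact: Ssub.1.
by apply: Ssub.2; [apply: Su | apply: Sv].
Qed.

Definition submod_genb A : V -> bool := fun v => `[< submod_gen A v >].

Fact submod_genb_closed A : zmod_closed (submod_genb A).
Proof.
have [S0 SD] := submod_gen_is_submod A.
split=> [|u v /asboolP Su /asboolP Sv]; first exact/asboolP.
by apply/asboolP; rewrite addrC -scaleN1r; apply: SD.
Qed.

HB.instance Definition _ A :=
  GRing.isZmodClosed.Build V (submod_genb A) (submod_genb_closed A).

Definition quot_mod A : Type :=
  Quotient.quot (GRing.ZmodClosed.clone V (submod_genb A) _).
HB.instance Definition _ A := GRing.Zmodule.on (quot_mod A).
HB.instance Definition _ A := EqQuotient.on (quot_mod A).

Section Scale.
Context (A : set V).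
Notation Q := (quot_mod A).

Lemma quot_mod_eqP (u v : V) :
  reflect (submod_gen A (u - v)) (\pi_Q u == \pi_Q v).
Proof.
apply: (iffP idP).
  by move/eqP/eqP; rewrite -Quotient.idealrBE => /asboolP.
by move=> h; rewrite -Quotient.idealrBE; apply/asboolP.
Qed.

Definition quot_scale (a : R) : Q -> Q := lift_op1 Q ( *:%R a).

Lemma quot_scaleE a v : quot_scale a (\pi_Q v) = \pi_Q (a *: v).
Proof.
unlock quot_scale; apply/eqP/quot_mod_eqP; rewrite -scalerBr -[_ *: _]addr0.
have [S0 SD] := submod_gen_is_submod A; apply: SD => //.
by apply/quot_mod_eqP; rewrite reprK.
Qed.

Lemma quot_addE u v : \pi_Q u + \pi_Q v = \pi_Q (u + v).
Proof. by rewrite Quotient.pi_add. Qed.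

Fact quot_scaleA a b x : quot_scale a (quot_scale b x) = quot_scale (a * b) x.
Proof.
rewrite -[x]reprK; move: (repr x) => v.
by rewrite (quot_scaleE b v) !quot_scaleE scalerA.
Qed.
Fact quot_scale1 : left_id 1 quot_scale.
Proof.
by move=> x; rewrite -[x]reprK quot_scaleE scale1r.
Qed.
Fact quot_scaleDr : right_distributive quot_scale +%R.
Proof.
move=> a x y; rewrite -[x]reprK -[y]reprK; move: (repr x) (repr y) => u v.
by rewrite quot_addE (quot_scaleE a u) (quot_scaleE a v) quot_scaleE quot_addE
  scalerDr.
Qed.
Fact quot_scaleDl x : {morph quot_scale^~ x : a b / a + b}.
Proof.
move=> a b; rewrite -[x]reprK; move: (repr x) => v.
by rewrite (quot_scaleE a v) (quot_scaleE b v) quot_scaleE quot_addE scalerDl.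
Qed.

HB.instance Definition _ := GRing.Zmodule_isLmodule.Build R Q
  quot_scaleA quot_scale1 quot_scaleDr quot_scaleDl.
End Scale.
End QuotMod.

(* [quot_alg A1] is the quotient of the algebra F by the two-sided ideal
   generated by A; the properness hypothesis A1 is there only because algebras
   are nontrivial by definition. *)
Section QuotAlg.
Context (K : comNzRingType) (F : algType K).
Implicit Types (I A : set F).

Definition is_ideal I :=
  [/\ I 0, forall u v, I u -> I v -> I (u - v)
    & forall p u q, I u -> I (p * u * q)].

Definition ideal_gen A : set F := smallest is_ideal A.

Lemma ideal_gen_is_ideal A : is_ideal (ideal_gen A).
Proof.
split=> [|u v Iu Iv|p u q Iu] I [Iid AI]; have [I0 IB IM] := Iid => //.
  by apply: IB; [apply: Iu | apply: Iv].
by apply: IM; apply: Iu.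
Qed.

Definition ideal_genb A : F -> bool := fun u => `[< ideal_gen A u >].

Fact ideal_genb_closed A : zmod_closed (ideal_genb A).
Proof.
have [I0 IB _] := ideal_gen_is_ideal A.
split=> [|u v /asboolP Iu /asboolP Iv]; first exact/asboolP.
by apply/asboolP; apply: IB.
Qed.

HB.instance Definition _ A :=
  GRing.isZmodClosed.Build F (ideal_genb A) (ideal_genb_closed A).

Definition quot_alg A (A1 : ~ ideal_gen A 1) : Type :=
  Quotient.quot (GRing.ZmodClosed.clone F (ideal_genb A) _).

Section Ops.
Context (A : set F) (A1 : ~ ideal_gen A 1).
Notation Q := (quot_alg A1).

HB.instance Definition _ := GRing.Zmodule.on Q.
HB.instance Definition _ := EqQuotient.on Q.

Lemma quot_alg_eqP (u v : F) :
  reflect (ideal_gen A (u - v)) (\pi_Q u == \pi_Q v).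
Proof.
apply: (iffP idP).
  by move/eqP/eqP; rewrite -Quotient.idealrBE => /asboolP.
by move=> h; rewrite -Quotient.idealrBE; apply/asboolP.
Qed.

Definition quot_one : Q := \pi_Q 1.
Definition quot_mul : Q -> Q -> Q := lift_op2 Q *%R.
Definition quot_ascale (a : K) : Q -> Q := lift_op1 Q ( *:%R a).

Lemma quot_aaddE u v : \pi_Q u + \pi_Q v = \pi_Q (u + v).
Proof. by rewrite Quotient.pi_add. Qed.

Lemma quot_mulE u v : quot_mul (\pi_Q u) (\pi_Q v) = \pi_Q (u * v).
Proof.
have [_ IB IM] := ideal_gen_is_ideal A.
unlock quot_mul; apply/eqP/quot_alg_eqP.
set u' := repr _; set v' := repr _.
have Iu : ideal_gen A (u' - u) by apply/quot_alg_eqP; rewrite reprK.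
have Iv : ideal_gen A (v - v').
  by apply/quot_alg_eqP; rewrite reprK.
rewrite (_ : _ - _ = 1 * (u' - u) * v' - u * (v - v') * 1); last first.
  by rewrite mul1r mulr1 mulrBl mulrBr opprB addrA subrK.
by apply: (IB); apply: (IM).
Qed.

Lemma quot_ascaleE a v : quot_ascale a (\pi_Q v) = \pi_Q (a *: v).
Proof.
have [_ IB IM] := ideal_gen_is_ideal A.
unlock quot_ascale; apply/eqP/quot_alg_eqP; rewrite -scalerBr.
rewrite -[X in _ *: X]mul1r scalerAl -[X in ideal_gen A X]mulr1.
by apply: (IM); apply/quot_alg_eqP; rewrite reprK.
Qed.

Fact quot_mulA : associative quot_mul.
Proof.
move=> x y z; rewrite -[x]reprK -[y]reprK -[z]reprK.
move: (repr x) (repr y) (repr z) => u v w.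
by rewrite (quot_mulE v w) (quot_mulE u v) !quot_mulE mulrA.
Qed.
Fact quot_mul1 : left_id quot_one quot_mul.
Proof. by move=> x; rewrite -[x]reprK quot_mulE mul1r. Qed.
Fact quot_mulr1 : right_id quot_one quot_mul.
Proof. by move=> x; rewrite -[x]reprK quot_mulE mulr1. Qed.
Fact quot_mulDl : left_distributive quot_mul +%R.
Proof.
move=> x y z; rewrite -[x]reprK -[y]reprK -[z]reprK.
move: (repr x) (repr y) (repr z) => u v w.
by rewrite quot_aaddE (quot_mulE u w) (quot_mulE v w) quot_mulE quot_aaddE mulrDl.
Qed.
Fact quot_mulDr : right_distributive quot_mul +%R.
Proof.
move=> x y z; rewrite -[x]reprK -[y]reprK -[z]reprK.
move: (repr x) (repr y) (repr z) => u v w.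
by rewrite quot_aaddE (quot_mulE u v) (quot_mulE u w) quot_mulE quot_aaddE mulrDr.
Qed.
Fact quot_one_neq0 : quot_one != 0.
Proof.
rewrite (_ : 0 = \pi_Q 0); last by rewrite pi_zeror.
by apply/negP => /quot_alg_eqP; rewrite subr0.
Qed.
HB.instance Definition _ := GRing.Zmodule_isNzRing.Build Q
  quot_mulA quot_mul1 quot_mulr1 quot_mulDl quot_mulDr quot_one_neq0.

Fact quot_ascaleA a b x :
  quot_ascale a (quot_ascale b x) = quot_ascale (a * b) x.
Proof.
rewrite -[x]reprK; move: (repr x) => v.
by rewrite (quot_ascaleE b v) !quot_ascaleE scalerA.
Qed.
Fact quot_ascale1 : left_id 1 quot_ascale.
Proof. by move=> x; rewrite -[x]reprK quot_ascaleE scale1r. Qed.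
Fact quot_ascaleDr : right_distributive quot_ascale +%R.
Proof.
move=> a x y; rewrite -[x]reprK -[y]reprK; move: (repr x) (repr y) => u v.
by rewrite quot_aaddE (quot_ascaleE a u) (quot_ascaleE a v) quot_ascaleE quot_aaddE scalerDr.
Qed.
Fact quot_ascaleDl x : {morph quot_ascale^~ x : a b / a + b}.
Proof.
move=> a b; rewrite -[x]reprK; move: (repr x) => v.
by rewrite (quot_ascaleE a v) (quot_ascaleE b v) quot_ascaleE quot_aaddE scalerDl.
Qed.
HB.instance Definition _ := GRing.Zmodule_isLmodule.Build K Q
  quot_ascaleA quot_ascale1 quot_ascaleDr quot_ascaleDl.

Fact quot_ascaleAl (a : K) (x y : Q) : a *: (x * y) = (a *: x) * y.
Proof.
rewrite -[x]reprK -[y]reprK; move: (repr x) (repr y) => u v.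
rewrite -[LHS]/(quot_ascale a (quot_mul _ _)) -[RHS]/(quot_mul (quot_ascale a _) _).
by rewrite quot_mulE (quot_ascaleE a u) quot_mulE quot_ascaleE scalerAl.
Qed.
Fact quot_ascaleAr (a : K) (x y : Q) : a *: (x * y) = x * (a *: y).
Proof.
rewrite -[x]reprK -[y]reprK; move: (repr x) (repr y) => u v.
rewrite -[LHS]/(quot_ascale a (quot_mul _ _)) -[RHS]/(quot_mul _ (quot_ascale a _)).
by rewrite (quot_mulE u v) (quot_ascaleE a v) quot_mulE quot_ascaleE scalerAr.
Qed.
HB.instance Definition _ := GRing.Lmodule_isLalgebra.Build K Q quot_ascaleAl.
HB.instance Definition _ := GRing.Lalgebra_isAlgebra.Build K Q quot_ascaleAr.
End Ops.
End QuotAlg.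

Section Periplectic.
Context (K : fieldType).

Definition pe2_pred : {pred 'M[K]_(2 + 2)} := fun x =>
  [&& drsubmx x == - (ulsubmx x)^T,
      (ursubmx x)^T == ursubmx x & (dlsubmx x)^T == - dlsubmx x].

Lemma pe2_predP (x : 'M[K]_(2 + 2)) :
  reflect (exists a b c : 'M[K]_2,
             [/\ x = block_mx a b c (- a^T), b^T = b & c^T = - c])
          (x \in pe2_pred).
Proof.
apply: (iffP and3P) => [[/eqP xdr /eqP xur /eqP xdl]|].
  exists (ulsubmx x), (ursubmx x), (dlsubmx x).
  by split; rewrite // -xdr submxK.
case=> a [b [c [-> b_sym c_skew]]].
by rewrite block_mxKul block_mxKur block_mxKdl block_mxKdr b_sym c_skew !eqxx.
Qed.

Fact pe2_submod : submod_closed pe2_pred.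
Proof.
split.
  apply/pe2_predP; exists 0, 0, 0; rewrite trmx0 oppr0; split=> //.
  by rewrite block_mx0.
move=> k x y /pe2_predP[a [b [c [-> bs cs]]]] /pe2_predP[a' [b' [c' [-> bs' cs']]]].
apply/pe2_predP; exists (k *: a + a'), (k *: b + b'), (k *: c + c').
rewrite scale_block_mx add_block_mx !linearP /= bs bs' cs cs'.
by split; rewrite ?scalerN ?opprD.
Qed.
HB.instance Definition _ :=
  GRing.isSubmodClosed.Build K 'M[K]_(2 + 2) pe2_pred pe2_submod.

Record pe2 : predArgType :=
  Pe2 { pe2_mx :> 'M[K]_(2 + 2); _ : pe2_mx \in pe2_pred }.
HB.instance Definition _ := [isSub for pe2_mx].
HB.instance Definition _ := [Choice of pe2 by <:].
HB.instance Definition _ := [SubChoice_isSubLmodule of pe2 by <:].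

(* x is homogeneous of parity p; zero has both parities. *)
Definition homogeneous (p : bool) (x : pe2) : bool :=
  if p then (ulsubmx x == 0) && (drsubmx x == 0)
  else (ursubmx x == 0) && (dlsubmx x == 0).

(* The superbracket of homogeneous elements of parities p and q. *)
Definition superbracket (p q : bool) (x y : 'M[K]_(2 + 2)) :=
  x *m y - (-1) ^+ (p && q) *: (y *m x).

Lemma superbracket_closed p q (x y : pe2) :
  homogeneous p x -> homogeneous q y -> superbracket p q x y \in pe2_pred.
Proof.
case: x y => [x Px] [y Py]; rewrite /homogeneous /superbracket /=.
case/pe2_predP: Px => a [b [c [-> bs cs]]].
case/pe2_predP: Py => a' [b' [c' [-> bs' cs']]].
rewrite !(block_mxKul, block_mxKur, block_mxKdl, block_mxKdr) => hx hy.
rewrite !mulmx_block scale_block_mx opp_block_mx add_block_mx.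
have trD (u v : 'M[K]_2) : (u + v)^T = u^T + v^T by rewrite linearD.
have trN (u : 'M[K]_2) : (- u)^T = - u^T by rewrite linearN.
apply/pe2_predP; do 3!eexists; split; first congr block_mx.
all: case: p q hx hy => -[] /andP[/eqP h1 /eqP h2] /andP[/eqP h3 /eqP h4].
all: rewrite /= ?expr1 ?expr0 ?scaleN1r ?scale1r ?opprK.
all: rewrite ?(trD, trN, trmx_mul, trmxK).
all: rewrite ?bs ?bs' ?cs ?cs' ?h1 ?h2 ?h3 ?h4.
all: rewrite ?(mulmxN, mulNmx, mul0mx, mulmx0, trmx0) ?(opprD, opprK, oppr0, add0r, addr0) //.
all: try by rewrite addrC.
Qed.

(* The free algebra on the underlying set of pe(2); its quotient by the
   linearity relations is the tensor algebra. *)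
Definition free_alg : Type := {malg K[{fmonom pe2}]}.
HB.instance Definition _ := GRing.Lalgebra.on free_alg.

Fact free_alg_scaleAr (a : K) (u v : {malg K[{fmonom pe2}]}) :
  a *: (u * v) = u * (a *: v).
Proof.
have aC : malgC a * u = u * malgC a.
  rewrite !malgM_def fgmulUg fgmulgU; apply: eq_bigr => m _.
  by rewrite mul1m mulm1 mulrC.
rewrite -(mul_malgC a v) [RHS]mulrA -aC -(mul_malgC a (u * v)).
exact: mulrA.
Qed.
HB.instance Definition _ := GRing.Lalgebra_isAlgebra.Build K free_alg free_alg_scaleAr.

Definition free_gen (x : pe2) : free_alg :=
  << fmu x >>.

Variant enveloping_rel : set free_alg :=
  | EnvLinear (k : K) (x y : pe2) :
      enveloping_rel (free_gen (k *: x + y) - (k *: free_gen x + free_gen y))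
  | EnvBracket (p q : bool) (x y : pe2)
      (hx : homogeneous p x) (hy : homogeneous q y) :
      enveloping_rel
        (free_gen x * free_gen y - (-1) ^+ (p && q) *: (free_gen y * free_gen x)
         - free_gen (Pe2 (superbracket_closed hx hy))).

Lemma enveloping_rel_proper : ~ ideal_gen enveloping_rel 1.
Proof.
pose aug (u : free_alg) : K := mcoeff (mone : {fmonom pe2}) u.
have augM u v : aug (u * v) = aug u * aug v by apply: rmorphM.
have augB u v : aug (u - v) = aug u - aug v by apply: raddfB.
have augD u v : aug (u + v) = aug u + aug v by apply: raddfD.
have augZ a u : aug (a *: u) = a * aug u by apply: mcoeffZ.
have aug_gen x : aug (free_gen x) = 0.
  rewrite /aug mcoeffU; case: eqP => // /(congr1 (@fmonom_val _)).
  by rewrite fm1 /fmu fmE.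
have aug_br k x y w :
    aug x = 0 -> aug y = 0 -> aug w = 0 -> aug (x - k *: y - w) = 0.
  by move=> x0 y0 w0; rewrite !augB augZ x0 y0 w0 mulr0 !subr0.
have aug_ideal : is_ideal [set u | aug u = 0].
  split=> [|u v /= u0 v0|p u q /= u0]; first exact: mcoeff0.
    by rewrite augB u0 v0 subr0.
  by rewrite !augM u0 mulr0 mul0r.
have rel0 : enveloping_rel `<=` [set u | aug u = 0].
  move=> _ [k x y|p q x y hx hy] /=.
    by rewrite augB augD augZ !aug_gen mulr0 addr0 subr0.
  by apply: aug_br; rewrite ?augM !aug_gen ?mulr0.
move=> /(_ _ (conj aug_ideal rel0)) /=.
by rewrite /aug mcoeffC eqxx mulr1n => /eqP; rewrite oner_eq0.
Qed.

Definition enveloping := quot_alg enveloping_rel_proper.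
HB.instance Definition _ := GRing.Algebra.on enveloping.

Definition envel (x : pe2) : enveloping := \pi_enveloping (free_gen x).

(* b = b_0 + g_1. *)
Definition borel : set pe2 :=
  [set x | ulsubmx x ord_max ord0 = 0 /\ dlsubmx x = 0].

(* The value at x in b of the character a e_1 + b e_2 of h, extended by zero to
   the nilradical of b; e_1, e_2 is dual to the basis E_ii - E_(2+i)(2+i) of h. *)
Definition weight (a b : K) (x : pe2) : K :=
  a * ulsubmx x ord0 ord0 + b * ulsubmx x ord_max ord_max.

(* U(g) (x)_U(b) C_lambda for lambda = a e_1 + b e_2. Identify U(g) (x) C_lambda
   with U(g) through u (x) 1 = u: since b generates U(b), balancing the tensor
   product over U(b) amounts to killing the left ideal generated by the
   x - lambda(x) for x in b. *)
Definition verma (a b : K) : lmodType enveloping :=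
  @quot_mod enveloping enveloping^o
    [set u | exists2 x, borel x & u = envel x - (weight a b x)%:A].

(* The union of the proper submodules. The submodule it generates, that is, the
   sum of the proper submodules, is the largest proper submodule of a Verma
   module, since every submodule of the latter is graded by weights and the
   highest weight space is a line generating the module. As the weight
   determines the parity, graded and ungraded submodules coincide. *)
Definition proper_submods (R : pzRingType) (V : lmodType R) : set V :=
  [set v | exists2 S, is_submod S /\ S <> setT & S v].

(* The unique simple quotient of [verma a b]. *)
Definition Lsimple (a b : K) : lmodType enveloping :=
  quot_mod (@proper_submods enveloping (verma a b)).

Definition annihilator (R : pzRingType) (V : lmodType R) : set R :=
  [set u | forall v : V, u *: v = 0].

Definition J (a b : K) : set enveloping := annihilator (Lsimple a b).

End Periplectic.

(* Sets X of subsets of T, ordered by inclusion. *)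
Section InclusionOrder.
Context (T : Type).
Implicit Types (P Q : set T) (X Y : set (set T)).

Definition comparable_in X P Q := [/\ X P, X Q & P `<=` Q \/ Q `<=` P].

Definition is_component X Y :=
  exists2 P, X P & Y = [set Q | X Q /\ clos_refl_trans _ (comparable_in X) P Q].

Definition covers_in X P Q :=
  [/\ X P, X Q, P `<` Q & ~ exists S, [/\ X S, P `<` S & S `<` Q]].

(* The edges E (P, Q), with P below Q, form the Hasse diagram of X: they are the
   covering relations, and these generate the order. *)
Definition is_hasse_diagram X (E : set T -> set T -> Prop) :=
  (forall P Q, covers_in X P Q <-> E P Q) /\
  (forall P Q, X P -> X Q -> (P `<=` Q <-> clos_refl_trans _ E P Q)).

End InclusionOrder.

Section Zigzag.
Context (K : fieldType).

Definition zigzag (a : K) : set (set (enveloping K)) :=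
  [set I | exists i : int,
     I = J (a + i%:~R) (a + i%:~R) \/ I = J (a + i%:~R) (a + i%:~R + 2)].

Definition zigzag_edge (a : K) (P Q : set (enveloping K)) :=
  exists i : int,
    P = J (a + i%:~R - 1) (a + i%:~R + 1) /\
    (Q = J (a + i%:~R - 1) (a + i%:~R - 1) \/ Q = J (a + i%:~R) (a + i%:~R)).

End Zigzag.

(* Main.v *)
Require Import Defs.
From HB Require Import structures.
From mathcomp Require Import all_boot all_order all_algebra.
From mathcomp Require Import finmap.
From mathcomp Require Import boolp classical_sets reals complex.
From mathcomp Require Import ring zify.
From mathcomp.multinomials Require Import monalg.
From Stdlib Require Import Relations.

(* Since g_{-1} is one-dimensional, M_(a,b) has basis y^n, y^n f (y in the root
   space of e_2 - e_1, f spanning g_{-1}), and g acts on it by operators whose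
   coefficients are polynomial in n. Letting n range over all of C gives a module
   of functions whose shift by a - b + 1 exchanges the parameters (a, b) and
   (b - 1, a + 1). Let phi_(a,b)(u) be the coefficient of the highest weight
   vector v in u v; then J(a, b) is the set of the u with phi_(a,b)(w u w') = 0
   for all w, w'. If a - b is not a natural number, then, by polynomiality, J(a, b)
   is the annihilator of the module of functions, which gives
   J(a, b) = Ann M_(a,b) = Ann M_(b-1,a+1), contained in J(b - 1, a + 1), and, for
   b = a + 2, contained in J(a, a), since f v spans a one-dimensional subquotient of
   weight (a, a) of M_(a+1,a+1).
   The other inclusions are excluded by the Casimir element and the trace of
   gl(2), which determine (a, b) up to these cases, and by y^(k+1), which lies in
   J(b + k, b) but not in J(b - 1, b + k + 1). *)

Set Implicit Arguments.
Unset Strict Implicit.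
Unset Printing Implicit Defensive.

Import GRing.Theory Num.Theory.
Local Open Scope classical_set_scope.
Local Open Scope ring_scope.
Local Open Scope quotient_scope.

(** * Coordinates on pe(2) and the superbracket in them *)

Section Elements.
Context (K : numFieldType).

Definition mx2 (a b c d : K) : 'M[K]_2 :=
  \matrix_(i < 2, j < 2)
    if i == ord0 then (if j == ord0 then a else b)
    else (if j == ord0 then c else d).

Lemma mx2_eta (A : 'M[K]_2) :
  A = mx2 (A ord0 ord0) (A ord0 ord_max) (A ord_max ord0) (A ord_max ord_max).
Proof.
by apply/matrixP=> -[[|[|//]] ?] [[|[|//]] ?]; rewrite !mxE /=;
  congr (A _ _); apply: val_inj.
Qed.

Lemma mx2M a b c d a' b' c' d' : mx2 a b c d *m mx2 a' b' c' d' =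
  mx2 (a * a' + b * c') (a * b' + b * d') (c * a' + d * c') (c * b' + d * d').
Proof.
by apply/matrixP=> -[[|[|//]] ?] [[|[|//]] ?];
  rewrite !mxE !big_ord_recl big_ord0 !mxE /= addr0.
Qed.

Lemma mx2D a b c d a' b' c' d' : mx2 a b c d + mx2 a' b' c' d' =
  mx2 (a + a') (b + b') (c + c') (d + d').
Proof. by apply/matrixP=> -[[|[|//]] ?] [[|[|//]] ?]; rewrite !mxE. Qed.

Lemma mx2N a b c d : - mx2 a b c d = mx2 (- a) (- b) (- c) (- d).
Proof. by apply/matrixP=> -[[|[|//]] ?] [[|[|//]] ?]; rewrite !mxE. Qed.

Lemma mx2Z k a b c d : k *: mx2 a b c d = mx2 (k * a) (k * b) (k * c) (k * d).
Proof. by apply/matrixP=> -[[|[|//]] ?] [[|[|//]] ?]; rewrite !mxE. Qed.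

Lemma mx2T a b c d : (mx2 a b c d)^T = mx2 a c b d.
Proof. by apply/matrixP=> -[[|[|//]] ?] [[|[|//]] ?]; rewrite !mxE. Qed.

Lemma mx20 : 0 = mx2 0 0 0 0.
Proof. by apply/matrixP=> -[[|[|//]] ?] [[|[|//]] ?]; rewrite !mxE. Qed.

Definition pe_mx (a b c d p q r g : K) : 'M[K]_(2 + 2) :=
  block_mx (mx2 a b c d) (mx2 p q q r) (mx2 0 g (- g) 0)
    (mx2 (- a) (- c) (- b) (- d)).

Lemma pe_mx_closed a b c d p q r g : pe_mx a b c d p q r g \in @pe2_pred K.
Proof.
apply/pe2_predP; exists (mx2 a b c d), (mx2 p q q r), (mx2 0 g (- g) 0).
by rewrite !mx2T !mx2N opprK oppr0.
Qed.

Definition pe a b c d p q r g : pe2 K := Pe2 (pe_mx_closed a b c d p q r g).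

Lemma two_neq0 : 2%:R != 0 :> K. Proof. by rewrite pnatr_eq0. Qed.

Lemma pe_surj (x : pe2 K) : exists a b c d p q r g, x = pe a b c d p q r g.
Proof.
case: x => x Px; case/pe2_predP: (Px) => A [B [C [Ex symB skC]]].
have eA := mx2_eta A; have eB := mx2_eta B; have eC := mx2_eta C.
have B10 : B ord_max ord0 = B ord0 ord_max by rewrite -[in LHS]symB mxE.
have C10 : C ord_max ord0 = - C ord0 ord_max.
  by have := congr1 (fun M : 'M_2 => M ord0 ord_max) skC; rewrite !mxE.
(* Skew-symmetry only gives [2 C i i = 0]; characteristic zero does the rest. *)
have Cii i : C i i = 0.
  have := congr1 (fun M : 'M_2 => M i i) skC; rewrite !mxE => /eqP.
  by rewrite -addr_eq0 -mulr2n -mulr_natr mulf_eq0 (negPf two_neq0) orbF => /eqP.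
exists (A ord0 ord0), (A ord0 ord_max), (A ord_max ord0), (A ord_max ord_max).
exists (B ord0 ord0), (B ord0 ord_max), (B ord_max ord_max), (C ord0 ord_max).
apply: val_inj; rewrite /= /pe_mx Ex {1 2}eA mx2T mx2N.
by congr block_mx; [rewrite {1}eB B10 | rewrite {1}eC C10 !Cii].
Qed.

Lemma pe_inj_mx a b c d p q r g (x : pe2 K) :
  pe2_mx x = pe_mx a b c d p q r g -> x = pe a b c d p q r g.
Proof. by move=> e; apply: val_inj. Qed.

Lemma pe_lin k a b c d p q r g a' b' c' d' p' q' r' g' :
  k *: pe a b c d p q r g + pe a' b' c' d' p' q' r' g' =
  pe (k * a + a') (k * b + b') (k * c + c') (k * d + d')
     (k * p + p') (k * q + q') (k * r + r') (k * g + g').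
Proof.
apply: pe_inj_mx.
rewrite [LHS](_ : _ = k *: pe_mx a b c d p q r g + pe_mx a' b' c' d' p' q' r' g').
  by rewrite /pe_mx scale_block_mx add_block_mx !mx2Z !mx2D; congr block_mx;
    congr mx2; ring.
by [].
Qed.

Lemma peZ k a b c d p q r g : k *: pe a b c d p q r g =
  pe (k * a) (k * b) (k * c) (k * d) (k * p) (k * q) (k * r) (k * g).
Proof.
apply: pe_inj_mx; rewrite [LHS](_ : _ = k *: pe_mx a b c d p q r g) //.
by rewrite /pe_mx scale_block_mx !mx2Z; congr block_mx; congr mx2; ring.
Qed.

Lemma pe0 : pe 0 0 0 0 0 0 0 0 = 0.
Proof. by rewrite -(scale0r (pe 0 0 0 0 0 0 0 0)) peZ !mul0r. Qed.

Lemma bracket_ee a b c d a' b' c' d' :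
  superbracket false false (pe a b c d 0 0 0 0) (pe a' b' c' d' 0 0 0 0) =
  pe_mx (b * c' - b' * c) (a * b' + b * d' - a' * b - b' * d)
    (c * a' + d * c' - c' * a - d' * c) (c * b' - c' * b) 0 0 0 0.
Proof.
rewrite /superbracket expr0 scale1r /= /pe_mx !mulmx_block opp_block_mx.
by rewrite !add_block_mx !mx2M !mx2D !mx2N !mx2D; congr block_mx; congr mx2; ring.
Qed.

Lemma bracket_eo a b c d p q r g :
  superbracket false true (pe a b c d 0 0 0 0) (pe 0 0 0 0 p q r g) =
  pe_mx 0 0 0 0 (2 * (a * p + b * q)) (a * q + b * r + c * p + d * q)
    (2 * (c * q + d * r)) (- (a + d) * g).
Proof.
rewrite /superbracket expr0 scale1r /= /pe_mx !mulmx_block opp_block_mx.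
by rewrite !add_block_mx !mx2M !mx2D !mx2N !mx2D; congr block_mx; congr mx2; ring.
Qed.

Lemma bracket_oe a b c d p q r g :
  superbracket true false (pe 0 0 0 0 p q r g) (pe a b c d 0 0 0 0) =
  pe_mx 0 0 0 0 (- (2 * (a * p + b * q))) (- (a * q + b * r + c * p + d * q))
    (- (2 * (c * q + d * r))) ((a + d) * g).
Proof.
rewrite /superbracket expr0 scale1r /= /pe_mx !mulmx_block opp_block_mx.
by rewrite !add_block_mx !mx2M !mx2D !mx2N !mx2D; congr block_mx; congr mx2; ring.
Qed.

Lemma bracket_oo p q r g p' q' r' g' :
  superbracket true true (pe 0 0 0 0 p q r g) (pe 0 0 0 0 p' q' r' g') =
  pe_mx (- (q * g' + q' * g)) (p * g' + p' * g) (- (r * g' + r' * g))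
    (q * g' + q' * g) 0 0 0 0.
Proof.
rewrite /superbracket expr1 scaleN1r opprK /= /pe_mx !mulmx_block.
by rewrite !add_block_mx !mx2M !mx2D; congr block_mx; congr mx2; ring.
Qed.

Lemma mx2_inj0 a b c d : mx2 a b c d = 0 -> [/\ a = 0, b = 0, c = 0 & d = 0].
Proof.
move=> e; have h i j : mx2 a b c d i j = 0 by rewrite e mxE.
by have := (h ord0 ord0, h ord0 ord_max, h ord_max ord0, h ord_max ord_max);
  rewrite !mxE /= => -[[[]]].
Qed.

Lemma homogeneous_even a b c d p q r g :
  homogeneous false (pe a b c d p q r g) -> [/\ p = 0, q = 0, r = 0 & g = 0].
Proof.
rewrite /homogeneous /= /pe_mx block_mxKur block_mxKdl.
by case/andP=> /eqP/mx2_inj0[-> -> _ ->] /eqP/mx2_inj0[_ -> _ _].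
Qed.

Lemma homogeneous_odd a b c d p q r g :
  homogeneous true (pe a b c d p q r g) -> [/\ a = 0, b = 0, c = 0 & d = 0].
Proof.
rewrite /homogeneous /= /pe_mx block_mxKul block_mxKdr.
by case/andP=> /eqP/mx2_inj0[-> -> -> ->].
Qed.

Lemma homogeneous_pe_even a b c d : homogeneous false (pe a b c d 0 0 0 0).
Proof.
by rewrite /homogeneous /= /pe_mx block_mxKur block_mxKdl oppr0 -mx20 eqxx.
Qed.

Lemma homogeneous_pe_odd p q r g : homogeneous true (pe 0 0 0 0 p q r g).
Proof.
by rewrite /homogeneous /= /pe_mx block_mxKul block_mxKdr !oppr0 -mx20 eqxx.
Qed.

End Elements.

(** * Generators, relations and induction for U(g) *)

Section Enveloping.
Context (K : numFieldType).
Notation U := (enveloping K).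
Notation F := (free_alg K).
Notation piU := (\pi_(enveloping K) : F -> U).

Lemma piU_D (u v : F) : piU (u + v) = piU u + piU v.
Proof. exact/esym/(quot_aaddE (@enveloping_rel_proper K)). Qed.

Lemma piU_M (u v : F) : piU (u * v) = piU u * piU v.
Proof. exact/esym/(quot_mulE (@enveloping_rel_proper K)). Qed.

Lemma piU_Z k (u : F) : piU (k *: u) = k *: piU u.
Proof. exact/esym/(quot_ascaleE (@enveloping_rel_proper K)). Qed.

Lemma piU_1 : piU 1 = 1.
Proof. by []. Qed.

Lemma piU_0 : piU 0 = 0.
Proof. by rewrite -(scale0r (0 : F)) piU_Z scale0r. Qed.

Lemma piU_eq (u v : F) : ideal_gen (@enveloping_rel K) (u - v) -> piU u = piU v.
Proof. by move=> h; apply/eqP/(quot_alg_eqP (@enveloping_rel_proper K)). Qed.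

Lemma malgUZ (k : K) (m : {fmonom (pe2 K)}) :
  << k *g m >> = k *: (<< m >> : F).
Proof. by apply/malgP=> m'; rewrite mcoeffZ !mcoeffU mulrnAr mulr1. Qed.

Lemma malgU_mul (m m' : {fmonom (pe2 K)}) :
  << mmul m m' >> = (<< m >> * << m' >> : F).
Proof.
have h : << mmul m m' >> = << m >> * << m' >> :> {malg K[{fmonom (pe2 K)}]}.
  by rewrite malgM_def fgmulUU mulr1.
exact h.
Qed.

Lemma free_ind (T : F -> Prop) :
  T 0 -> (forall k m u, T u -> T (k *: << m >> + u)) -> forall u, T u.
Proof.
move=> T0 TD u.
have -> : u = \sum_(m <- msupp u) u@_m *: << m >>.
  by rewrite {1}[u]monalgE; apply: eq_bigr => m _; rewrite malgUZ.
elim: (enum_fset _) => [|m s IH]; first by rewrite big_nil.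
by rewrite big_cons; apply: TD.
Qed.

Lemma envel_lin k (x y : pe2 K) : envel (k *: x + y) = k *: envel x + envel y.
Proof.
rewrite /envel -piU_Z -piU_D; apply: piU_eq => I [_ sub].
by apply: sub; apply: EnvLinear.
Qed.

Lemma envel_bracket p q (x y z : pe2 K) :
  homogeneous p x -> homogeneous q y ->
  superbracket p q x y = z ->
  envel x * envel y = (-1) ^+ (p && q) *: (envel y * envel x) + envel z.
Proof.
move=> hx hy ez.
have -> : z = Pe2 (superbracket_closed hx hy) by apply: val_inj; rewrite /= ez.
rewrite /envel -!piU_M -piU_Z -piU_D; apply: piU_eq => I [_ sub].
by apply: sub; rewrite opprD addrA; apply: EnvBracket.
Qed.

(** Words in the generators are built letter by letter from the left, so a subspace containing [1]
    and stable under left multiplication by generators is everything. *)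
Lemma enveloping_ind (T : set U) :
  T 1 -> (forall u v, T u -> T v -> T (u + v)) ->
  (forall k u, T u -> T (k *: u)) ->
  (forall x u, T u -> T (envel x * u)) -> forall u, T u.
Proof.
move=> T1 TD TZ TM u; rewrite -[u]reprK.
have T0 : T 0 by rewrite -(scale0r 1); apply: TZ.
have Tm (m : {fmonom (pe2 K)}) : T (piU << m >>).
  case: m; elim=> [|x s IH].
    by rewrite (_ : FMonom [::] = mone) // -fmoneE.
  have -> : FMonom (x :: s) = mmul (fmu x) (FMonom s).
    by apply/eqP; rewrite fmP fmM fmU.
  by rewrite malgU_mul piU_M; apply: TM.
elim/free_ind: (repr u) => [|k m v IH]; first by rewrite piU_0.
by rewrite piU_D piU_Z; apply: TD => //; apply: TZ.
Qed.

End Enveloping.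

(** * The module of functions on [K] with parameters [(al, be)] *)

Section GenericModule.
Context (K : numFieldType).
Implicit Types (s al be : K) (w : bool -> K -> K).
Notation U := (enveloping K).
Notation F := (free_alg K).

(* A pair of functions w stands for the formal sum over s in K of
   w false s * (y^s v) + w true s * (y^s f v), where v has weight (al, be). *)
Definition gl2_op al be (a b c d : K) (h : K -> K) s : K :=
  (a * (al - s) + d * (be + s)) * h s
  + b * (s + 1) * (al - be - s) * h (s + 1) + c * h (s - 1).

(* The off-diagonal blocks: [b, f] = b J for b in g_1, with J = [[0,1],[-1,0]],
   the lower left block of f. *)
Definition pe_op al be (x : pe2 K) w (j : bool) s : K :=
  let A := ulsubmx (x : 'M_(2 + 2)) in
  let B := ursubmx (x : 'M_(2 + 2)) in
  if j then
    gl2_op (al - 1) (be - 1) (A ord0 ord0) (A ord0 ord_max) (A ord_max ord0)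
      (A ord_max ord_max) (w true) s
    + dlsubmx (x : 'M_(2 + 2)) ord0 ord_max * w false s
  else
    gl2_op al be (A ord0 ord0) (A ord0 ord_max) (A ord_max ord0)
      (A ord_max ord_max) (w false) s
    + gl2_op al be (- B ord0 ord_max) (B ord0 ord0) (- B ord_max ord_max)
      (B ord0 ord_max) (w true) s.

Lemma pe_opE al be a b c d p q r g w j s :
  pe_op al be (pe a b c d p q r g) w j s =
  if j then gl2_op (al - 1) (be - 1) a b c d (w true) s + g * w false s
  else gl2_op al be a b c d (w false) s + gl2_op al be (- q) p (- r) q (w true) s.
Proof.
by rewrite /pe_op /= /pe_mx block_mxKul block_mxKur block_mxKdl !mxE.
Qed.

Lemma gl2_op_lin al be a b c d k (f h : K -> K) s :
  gl2_op al be a b c d (fun t => k * f t + h t) s =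
  k * gl2_op al be a b c d f s + gl2_op al be a b c d h s.
Proof. rewrite /gl2_op; ring. Qed.

Lemma pe_op_lin al be x k w w' j s :
  pe_op al be x (fun i t => k * w i t + w' i t) j s =
  k * pe_op al be x w j s + pe_op al be x w' j s.
Proof. by rewrite /pe_op; case: j; rewrite !gl2_op_lin; ring. Qed.

Definition word_act al be (m : seq (pe2 K)) w := foldr (pe_op al be) w m.

Lemma word_act_lin al be m k w w' j s :
  word_act al be m (fun i t => k * w i t + w' i t) j s =
  k * word_act al be m w j s + word_act al be m w' j s.
Proof.
elim: m j s => [//|x m IH] j s /=; rewrite -pe_op_lin.
by congr pe_op; apply/funext=> i; apply/funext=> t; apply: IH.
Qed.

Definition free_act al be (u : F) w (j : bool) s : K :=
  mmap idfun (fun m : {fmonom (pe2 K)} => word_act al be m w j s) u.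

Lemma free_actD al be u v w j s :
  free_act al be (u + v) w j s = free_act al be u w j s + free_act al be v w j s.
Proof. exact: mmapD. Qed.

Lemma free_actU al be m w j s :
  free_act al be << m >> w j s = word_act al be m w j s.
Proof. by rewrite /free_act mmapU mul1r. Qed.

Lemma free_actZ al be k u w j s :
  free_act al be (k *: u) w j s = k * free_act al be u w j s.
Proof.
rewrite /free_act (mmapEw (msuppZ_le _ _)) mmapE big_distrr /=.
by apply: eq_bigr=> m _; rewrite mcoeffZ mulrA.
Qed.

Lemma free_act0 al be w j s : free_act al be 0 w j s = 0.
Proof. exact: mmap0. Qed.

Lemma free_act_lin al be u k w w' j s :
  free_act al be u (fun i t => k * w i t + w' i t) j s =
  k * free_act al be u w j s + free_act al be u w' j s.
Proof.
elim/free_ind: u => [|k' m u IH]; first by rewrite !free_act0; ring.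
by rewrite !free_actD !free_actZ !free_actU IH word_act_lin; ring.
Qed.

Lemma word_act0 al be m j s : word_act al be m (fun _ _ => 0) j s = 0.
Proof.
pose w0 := fun (_ : bool) (_ : K) => 0 : K.
have e : (fun i t => -1 * w0 i t + w0 i t) = w0.
  by apply/funext=> i; apply/funext=> t; rewrite mulr0 addr0.
by have := word_act_lin al be m (-1) w0 w0 j s; rewrite e mulN1r addNr.
Qed.

Lemma free_actM_mon al be m v w j s :
  free_act al be (<< m >> * v) w j s = word_act al be m (free_act al be v w) j s.
Proof.
elim/free_ind: v => [|k m' v IH].
  rewrite mulr0 free_act0 -[LHS](word_act0 al be m j s); congr word_act.
  by apply/funext=> i; apply/funext=> t; rewrite free_act0.
have e : << m >> * << m' >> = << mmul m m' >> :> F by rewrite malgU_mul.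
rewrite (mulrDr (<< m >> : F)) -(scalerAr k (<< m >> : F)) e free_actD IH {IH e}.
have e : free_act al be (k *: << m' >> + v) w =
    fun i t => k * word_act al be m' w i t + free_act al be v w i t.
  apply/funext=> i; apply/funext=> t; rewrite free_actD; congr (_ + _).
  by rewrite (free_actZ al be k << m' >>) free_actU.
rewrite e word_act_lin; congr (_ + _).
rewrite (free_actZ al be k << _ >>) free_actU fmM.
by rewrite /word_act foldr_cat.
Qed.

Lemma free_act_linl al be k u v w j s :
  free_act al be (k *: u + v) w j s =
  k * free_act al be u w j s + free_act al be v w j s.
Proof. by rewrite (free_actD al be (k *: u)) (free_actZ al be k u). Qed.

Lemma free_actM al be u v w j s :
  free_act al be (u * v) w j s = free_act al be u (free_act al be v w) j s.
Proof.
elim/free_ind: u => [|k m u IH]; first by rewrite mul0r !free_act0.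
have e := free_actM_mon al be m v w j s.
have e' := free_actU al be m (free_act al be v w) j s.
rewrite [RHS]free_act_linl -IH e' -e (mulrDl (k *: << m >> : F) u v).
by rewrite -(scalerAl k (<< m >> : F) v); exact: free_act_linl.
Qed.

Lemma free_act_gen al be x w j s :
  free_act al be (free_gen x) w j s = pe_op al be x w j s.
Proof. by rewrite free_actU fmU. Qed.

(** In coordinates each parity case is a polynomial identity in [s], [al], [be] and the values of
    [w], so it holds for all [s] in [K] and not only on the indices of a Verma module. *)
Lemma pe_op_bracket al be p q (x y z : pe2 K) w j s :
  homogeneous p x -> homogeneous q y -> superbracket p q x y = z ->
  pe_op al be x (pe_op al be y w) j s =
  (-1) ^+ (p && q) * pe_op al be y (pe_op al be x w) j s + pe_op al be z w j s.
Proof.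
have [a [b [c [d [e [f [g [h ->]]]]]]]] := pe_surj x.
have [a' [b' [c' [d' [e' [f' [g' [h' ->]]]]]]]] := pe_surj y.
case: p q => [] [].
- move=> /homogeneous_odd[-> -> -> ->] /homogeneous_odd[-> -> -> ->].
  rewrite bracket_oo => /esym/pe_inj_mx -> /=.
  rewrite !pe_opE; case: j; rewrite /gl2_op !pe_opE /gl2_op ?addrK ?subrK.
    ring.
  ring.
- move=> /homogeneous_odd[-> -> -> ->] /homogeneous_even[-> -> -> ->].
  rewrite bracket_oe => /esym/pe_inj_mx -> /=.
  rewrite !pe_opE; case: j; rewrite /gl2_op !pe_opE /gl2_op ?addrK ?subrK.
    ring.
  ring.
- move=> /homogeneous_even[-> -> -> ->] /homogeneous_odd[-> -> -> ->].
  rewrite bracket_eo => /esym/pe_inj_mx -> /=.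
  rewrite !pe_opE; case: j; rewrite /gl2_op !pe_opE /gl2_op ?addrK ?subrK.
    ring.
  ring.
- move=> /homogeneous_even[-> -> -> ->] /homogeneous_even[-> -> -> ->].
  rewrite bracket_ee => /esym/pe_inj_mx -> /=.
  rewrite !pe_opE; case: j; rewrite /gl2_op !pe_opE /gl2_op ?addrK ?subrK.
    ring.
  ring.
Qed.

Lemma free_actN al be u w j s : free_act al be (- u) w j s = - free_act al be u w j s.
Proof. exact: mmapN. Qed.

Lemma free_act_linear_rel al be k (x y : pe2 K) w j s :
  free_act al be (free_gen (k *: x + y) - (k *: free_gen x + free_gen y)) w j s
  = 0.
Proof.
rewrite (free_actD _ _ (free_gen _)) free_actN free_act_linl !free_act_gen.
have [a [b [c [d [e [f [g [h ->]]]]]]]] := pe_surj x.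
have [a' [b' [c' [d' [e' [f' [g' [h' ->]]]]]]]] := pe_surj y.
rewrite pe_lin !pe_opE /gl2_op; case: j; ring.
Qed.

Lemma free_act_bracket_rel al be p q (x y z : pe2 K) w j s :
  homogeneous p x -> homogeneous q y -> superbracket p q x y = z ->
  free_act al be (free_gen x * free_gen y
    - (-1) ^+ (p && q) *: (free_gen y * free_gen x) - free_gen z) w j s = 0.
Proof.
move=> hx hy ez.
have E x' y' : free_act al be (free_gen x' * free_gen y') w j s =
    pe_op al be x' (pe_op al be y' w) j s.
  rewrite free_actM free_act_gen; congr pe_op.
  by apply/funext=> i; apply/funext=> t; rewrite free_act_gen.
have := pe_op_bracket al be w j s hx hy ez.
rewrite -!E -free_act_gen; move: (free_gen x * free_gen y) => u.
move: (free_gen y * free_gen x) (free_gen z) => v v' e.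
rewrite (free_actD _ _ (u - _)) (free_actD _ _ u) (free_actN _ _ v').
by rewrite (free_actN _ _ (_ *: v)) (free_actZ _ _ _ v) e; ring.
Qed.

(** The elements acting by zero form a two-sided ideal containing the defining relations, so the
    action descends to U(g). *)
Lemma free_act_rel al be (u : F) :
  ideal_gen (@enveloping_rel K) u -> forall w j s, free_act al be u w j s = 0.
Proof.
pose I0 := [set u : F | forall w j s, free_act al be u w j s = 0].
have id0 : is_ideal I0.
  split=> [w j s|u1 v u0 v0 w j s|a v b v0 w j s]; first exact: free_act0.
    by rewrite free_actD free_actN u0 v0 subr0.
  rewrite !free_actM -[RHS](free_act0 al be w j s) -[in RHS](mulr0 a) free_actM.
  congr free_act; apply/funext=> i; apply/funext=> t.
  by rewrite v0 free_act0.
have sub : @enveloping_rel K `<=` I0.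
  move=> _ [k x y|p q x y hx hy] w j s; first exact: free_act_linear_rel.
  exact: (free_act_bracket_rel _ _ _ _ _ hx hy).
by move=> h; exact: (h I0 (conj id0 sub)).
Qed.

(** The choice of representative is immaterial by [eact_pi]. *)
Definition eact al be (u : U) := free_act al be (repr u).

Lemma eact_pi al be (u : F) w j s :
  eact al be (\pi_(enveloping K) u) w j s = free_act al be u w j s.
Proof.
rewrite /eact; set v := repr _.
have /(free_act_rel al be)/(_ w j s) : ideal_gen (@enveloping_rel K) (v - u).
  by apply/(quot_alg_eqP (@enveloping_rel_proper K)); rewrite reprK.
by rewrite -scaleN1r free_actD free_actZ mulN1r => /subr0_eq.
Qed.

Lemma eactD al be u v w j s :
  eact al be (u + v) w j s = eact al be u w j s + eact al be v w j s.
Proof. by rewrite -{1}[u]reprK -{1}[v]reprK -piU_D eact_pi free_actD. Qed.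

Lemma eactZ al be k u w j s : eact al be (k *: u) w j s = k * eact al be u w j s.
Proof. by rewrite -{1}[u]reprK -piU_Z eact_pi free_actZ. Qed.

Lemma eactM al be u v w j s :
  eact al be (u * v) w j s = eact al be u (eact al be v w) j s.
Proof. by rewrite -{1}[u]reprK -{1}[v]reprK -piU_M eact_pi free_actM. Qed.

Lemma eact1 al be w j s : eact al be 1 w j s = w j s.
Proof. by rewrite -piU_1 eact_pi free_actU fm1. Qed.

Lemma eact_envel al be x w j s :
  eact al be (envel x) w j s = pe_op al be x w j s.
Proof. by rewrite /envel eact_pi free_act_gen. Qed.

Lemma eact_lin al be u k w w' j s :
  eact al be u (fun i t => k * w i t + w' i t) j s =
  k * eact al be u w j s + eact al be u w' j s.
Proof. exact: free_act_lin. Qed.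

End GenericModule.

(* What is used of U(g). An abstract algebra with these properties keeps the
   quotient of the free algebra from being unfolded during unification. *)
Record is_envelope (K : numFieldType) (U : algType K) (e : pe2 K -> U) : Prop :=
  IsEnvelope {
    e_lin : forall k x y, e (k *: x + y) = k *: e x + e y;
    e_bracket : forall p q (x y z : pe2 K),
      homogeneous p x -> homogeneous q y -> superbracket p q x y = z ->
      e x * e y = (-1) ^+ (p && q) *: (e y * e x) + e z;
    e_ind : forall T : set U, T 1 -> (forall u v, T u -> T v -> T (u + v)) ->
      (forall k u, T u -> T (k *: u)) -> (forall x u, T u -> T (e x * u)) ->
      forall u, T u }.

(** * The left ideal defining a Verma module, and the monomials spanning its complement *)

Section VermaIdeal.
Context (K : numFieldType) (U : algType K) (e : pe2 K -> U).
Context (eP : is_envelope e).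
Implicit Types (al be k : K) (u v : U).

Definition genY : U := e (pe 0 0 1 0 0 0 0 0).
Definition genF : U := e (pe 0 0 0 0 0 0 0 1).

Definition verma_ideal al be : set U :=
  @submod_gen U U^o
    [set u | exists2 x, borel x & u = e x - (weight al be x)%:A].

Lemma verma_idealM al be u v : verma_ideal al be v -> verma_ideal al be (u * v).
Proof.
have [h0 hD] := submod_gen_is_submod (V := U^o)
  [set u | exists2 x, borel x & u = e x - (weight al be x)%:A].
by move=> hv; have := hD u v 0 hv h0; rewrite addr0.
Qed.

Lemma verma_idealD al be u v :
  verma_ideal al be u -> verma_ideal al be v -> verma_ideal al be (u + v).
Proof.
have [h0 hD] := submod_gen_is_submod (V := U^o)
  [set u | exists2 x, borel x & u = e x - (weight al be x)%:A].
by move=> hu hv; have := hD 1 u v hu hv; rewrite scale1r.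
Qed.

Lemma verma_idealZ al be k u : verma_ideal al be u -> verma_ideal al be (k *: u).
Proof. by move=> hu; rewrite -[u]mul1r scalerAl; apply: verma_idealM. Qed.

Lemma verma_ideal_borel al be x :
  borel x -> verma_ideal al be (e x - (weight al be x)%:A).
Proof. by move=> bx I [_ sub]; apply: sub; exists x. Qed.

Lemma e_0 : e 0 = 0.
Proof. by have := e_lin eP (-1) 0 0; rewrite scaleN1r oppr0 addr0 scaleN1r addNr. Qed.

Lemma e_scale k x : e (k *: x) = k *: e x.
Proof. by rewrite -[k *: x]addr0 (e_lin eP) e_0 addr0. Qed.

Lemma pe_split a b c d p q r g :
  e (pe a b c d p q r g) =
  g *: genF + (c *: genY + e (pe a b 0 d p q r 0)) :> U.
Proof. by rewrite -!(e_lin eP) !pe_lin; congr (e (pe _ _ _ _ _ _ _ _)); ring. Qed.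

Lemma envel_parity a b c d p q r g :
  e (pe a b c d p q r g) =
  e (pe a b c d 0 0 0 0) + e (pe 0 0 0 0 p q r g) :> U.
Proof.
by rewrite -[in RHS](scale1r (e _)) -(e_lin eP) pe_lin;
  congr (e (pe _ _ _ _ _ _ _ _)); ring.
Qed.

Lemma even_genY a b c d :
  e (pe a b c d 0 0 0 0) * genY =
  genY * e (pe a b c d 0 0 0 0) + e (pe b 0 (d - a) (- b) 0 0 0 0) :> U.
Proof.
rewrite (e_bracket eP (homogeneous_pe_even a b c d)
  (homogeneous_pe_even 0 0 1 0) (z := pe b 0 (d - a) (- b) 0 0 0 0)) ?scale1r //.
by rewrite bracket_ee; congr pe_mx; ring.
Qed.

Lemma odd_genY p q r g :
  e (pe 0 0 0 0 p q r g) * genY =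
  genY * e (pe 0 0 0 0 p q r g) + e (pe 0 0 0 0 0 (- p) (- (2 * q)) 0) :> U.
Proof.
rewrite (e_bracket eP (homogeneous_pe_odd p q r g)
  (homogeneous_pe_even 0 0 1 0) (z := pe 0 0 0 0 0 (- p) (- (2 * q)) 0)) ?scale1r //.
by rewrite bracket_oe; congr pe_mx; ring.
Qed.

(** Moving a generator past [Y] costs a single other generator, because [Y] is even; this drives the
    induction in [spansT]. *)
Lemma envel_genY x : exists x', e x * genY = genY * e x + e x' :> U.
Proof.
have [a [b [c [d [p [q [r [g ->]]]]]]]] := pe_surj x.
exists (pe b 0 (d - a) (- b) 0 (- p) (- (2 * q)) 0).
rewrite envel_parity [e (pe b _ _ _ _ _ _ _)]envel_parity mulrDl mulrDr.
by rewrite even_genY odd_genY addrACA.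
Qed.

Lemma even_genF a b c d :
  e (pe a b c d 0 0 0 0) * genF =
  genF * e (pe a b c d 0 0 0 0) - (a + d) *: genF :> U.
Proof.
rewrite (e_bracket eP (homogeneous_pe_even a b c d)
  (homogeneous_pe_odd 0 0 0 1) (z := pe 0 0 0 0 0 0 0 (- (a + d)))) ?scale1r; last first.
  by rewrite bracket_eo; congr pe_mx; ring.
congr (_ + _); rewrite /genF -scaleNr -(e_scale _ (pe 0 0 0 0 0 0 0 1)) peZ.
by rewrite !mulr0 mulr1.
Qed.

Lemma odd_genF p q r g :
  e (pe 0 0 0 0 p q r g) * genF =
  - (genF * e (pe 0 0 0 0 p q r g)) + e (pe (- q) p (- r) q 0 0 0 0) :> U.
Proof.
rewrite (e_bracket eP (homogeneous_pe_odd p q r g)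
  (homogeneous_pe_odd 0 0 0 1) (z := pe (- q) p (- r) q 0 0 0 0)).
  by rewrite expr1 scaleN1r.
by rewrite bracket_oo; congr pe_mx; ring.
Qed.

Lemma genYF : genF * genY = genY * genF.
Proof. by rewrite even_genF addr0 scale0r subr0. Qed.

Lemma genFF : genF * genF = 0.
Proof.
have := odd_genF 0 0 0 1; rewrite -/genF oppr0 pe0 e_0.
rewrite addr0 => /eqP; rewrite -addr_eq0 -mulr2n -scaler_nat => /eqP E.
by rewrite -[LHS]scale1r -(mulVf (two_neq0 K)) -scalerA E scaler0.
Qed.

Definition pbw (i : nat) (j : bool) : U := genY ^+ i * genF ^+ j.

Definition spans al be (T : set U) :=
  [/\ forall u v, T u -> T v -> T (u + v), forall k u, T u -> T (k *: u),
      verma_ideal al be `<=` T & forall i j, T (pbw i j)].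

(** The spanning half of the PBW theorem modulo the Verma ideal. As [T] itself need not be stable
    under left multiplication, the proof works with the intersection [T0] of all such sets: there
    stability can be tested on the monomials, the Verma ideal being a left ideal already. *)
Lemma spansT al be T : spans al be T -> forall u, T u.
Proof.
move=> spT; pose T0 : set U := [set u | forall T, spans al be T -> T u].
suff h : forall u, T0 u by move=> u; apply: h.
have T0D u v : T0 u -> T0 v -> T0 (u + v).
  by move=> hu hv S spS; case: (spS) => SD _ _ _; apply: SD; [apply: hu|apply: hv].
have T0Z k u : T0 u -> T0 (k *: u).
  by move=> hu S spS; case: (spS) => _ SZ _ _; apply: SZ; apply: hu.
have T0V : verma_ideal al be `<=` T0 by move=> v hv S [_ _ SV _]; apply: SV.
have T0P i j : T0 (pbw i j) by move=> S [_ _ _]; apply.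
have T0M x : (forall i j, T0 (x * pbw i j)) -> forall u, T0 u -> T0 (x * u).
  move=> hx u0 /(_ [set u | T0 (x * u)]); apply; split => //=.
  - by move=> u1 v hu hv; rewrite mulrDr; apply: T0D.
  - by move=> k u1 hu; rewrite -scalerAr; apply: T0Z.
  - by move=> v hv; apply: T0V; apply: verma_idealM.
have T0Y : forall u, T0 u -> T0 (genY * u).
  by apply: T0M => i j; rewrite /pbw mulrA -exprS; apply: T0P.
have FY i : genF * genY ^+ i = genY ^+ i * genF.
  elim: i => [|i IH]; first by rewrite expr0 mul1r mulr1.
  by rewrite exprS mulrA genYF -mulrA IH mulrA.
have T00 : T0 0 by rewrite -(scale0r 1) -(mulr1 1); apply: T0Z; exact: (T0P 0%N false).
have T0F : forall u, T0 u -> T0 (genF * u).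
  apply: T0M => i j; rewrite /pbw mulrA FY -mulrA.
  case: j; last by rewrite mulr1 -(expr1 genF); exact: (T0P i true).
  by rewrite expr1 genFF mulr0.
have T0x x : T0 (e x).
  have [a [b [c [d [p [q [r [g ->]]]]]]]] := pe_surj x.
  rewrite pe_split; apply: (T0D); first apply: (T0Z).
    by rewrite -[genF]mul1r -[genF]expr1; exact: (T0P 0%N true).
  apply: (T0D); first apply: (T0Z).
    by rewrite -[genY]mulr1 -[genY]expr1; exact: (T0P 1%N false).
  (* What remains lies in the Borel subalgebra, hence is a scalar modulo the Verma ideal. *)
  rewrite -[e _](subrK (weight al be (pe a b 0 d p q r 0))%:A).
  apply: (T0D); last by apply: T0Z; rewrite -(mulr1 1); exact: (T0P 0%N false).
  apply: T0V; apply: verma_ideal_borel; split.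
    by rewrite /= /pe_mx block_mxKul mxE.
  by rewrite /= /pe_mx block_mxKdl oppr0 -mx20.
have T0xF x : T0 (e x * genF).
  have [a [b [c [d [p [q [r [g ->]]]]]]]] := pe_surj x.
  rewrite envel_parity mulrDl even_genF odd_genF -scaleNr -scaleN1r.
  apply: (T0D); apply: (T0D) => //; first exact: T0F.
    by apply: T0Z; apply: T0x.
  by apply: T0Z; apply: T0F.
apply: (e_ind eP (T := T0)) => //.
  by rewrite -(mulr1 1); exact: (T0P 0%N false).
move=> x u1 hu; apply: T0M hu => i j.
(* The induction runs over all [x] at once, since passing [Y] replaces [x] by [x']. *)
elim: i x => [|i IH] x; first by rewrite /pbw mul1r; case: j; rewrite ?expr1 ?mulr1.
have [x' E] := envel_genY x.
rewrite /pbw exprS -!mulrA mulrA E mulrDl; apply: T0D; last exact: IH.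
by rewrite -mulrA; apply: T0Y; apply: IH.
Qed.

End VermaIdeal.

(** * The highest weight coefficient and its vanishing on proper submodules *)

Record is_action (K : numFieldType) (U : algType K) (e : pe2 K -> U)
    (act : K -> K -> U -> (bool -> K -> K) -> bool -> K -> K) : Prop :=
  IsAction {
    actD : forall al be u v w j s,
      act al be (u + v) w j s = act al be u w j s + act al be v w j s;
    actZ : forall al be k u w j s,
      act al be (k *: u) w j s = k * act al be u w j s;
    actM : forall al be u v w j s,
      act al be (u * v) w j s = act al be u (act al be v w) j s;
    act1 : forall al be w j s, act al be 1 w j s = w j s;
    act_e : forall al be x w j s, act al be (e x) w j s = pe_op al be x w j s;
    act_lin : forall al be u k w w' j s,
      act al be u (fun i t => k * w i t + w' i t) j s =
      k * act al be u w j s + act al be u w' j s }.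

Section Action.
Context (K : numFieldType) (U : algType K) (e : pe2 K -> U).
Context (act : K -> K -> U -> (bool -> K -> K) -> bool -> K -> K).
Context (eP : is_envelope e) (aP : is_action e act).
Implicit Types (al be k s t : K) (u v : U) (w : bool -> K -> K) (i j : bool).

Lemma act_wext al be u w w' : w =2 w' -> act al be u w = act al be u w'.
Proof. by move=> h; congr act; apply/funext=> i; apply/funext=> t. Qed.

Lemma act_0l al be w j s : act al be 0 w j s = 0.
Proof. by rewrite -(scale0r 0) (actZ aP) mul0r. Qed.

Lemma act_N al be u w j s : act al be (- u) w j s = - act al be u w j s.
Proof. by rewrite -scaleN1r (actZ aP) mulN1r. Qed.

Lemma act_A al be k w j s : act al be k%:A w j s = k * w j s.
Proof. by rewrite (actZ aP) (act1 aP). Qed.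

Lemma act_0r al be u j s : act al be u (fun _ _ => 0) j s = 0.
Proof.
pose w0 := fun (_ : bool) (_ : K) => 0 : K.
have := act_lin aP al be u (-1) w0 w0 j s; rewrite mulN1r addNr.
rewrite (@act_wext _ _ _ (fun i t => -1 * w0 i t + w0 i t) w0) //.
by move=> i t; rewrite mulr0 addr0.
Qed.

Lemma act_Zr al be u k w j s :
  act al be u (fun i t => k * w i t) j s = k * act al be u w j s.
Proof.
rewrite -[RHS]addr0 -(act_0r al be u j s) -(act_lin aP).
by rewrite (@act_wext _ _ _ _ (fun i t => k * w i t + 0)) // => i t; rewrite addr0.
Qed.

(** The tool for exhibiting submodules of the module of functions: only generators of U(g) have to
    be checked. *)
Lemma act_stable al be (S : set (bool -> K -> K)) :
  (forall k w w', S w -> S w' -> S (fun i t => k * w i t + w' i t)) ->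
  (forall x w, S w -> S (pe_op al be x w)) ->
  forall u w, S w -> S (act al be u w).
Proof.
move=> Slin Sop u w Sw; move: u.
have E (w1 w2 : bool -> K -> K) : w1 =2 w2 -> S w1 -> S w2.
  by move=> h; rewrite (_ : w1 = w2) //; apply/funext=> i; apply/funext=> t.
have S0 : S (fun _ _ => 0).
  apply: (E (fun i t => -1 * w i t + w i t)); last exact: Slin.
  by move=> i t; rewrite mulN1r addNr.
apply: (e_ind eP (T := [set u | S (act al be u w)])) => /=.
- by apply: (E w) => // i t; rewrite (act1 aP).
- move=> u v Su Sv.
  apply: (E (fun i t => 1 * act al be u w i t + act al be v w i t)); last exact: Slin.
  by move=> i t; rewrite (actD aP) mul1r.
- move=> k u Su; apply: (E (fun i t => k * act al be u w i t + 0)); last exact: Slin.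
  by move=> i t; rewrite (actZ aP) addr0.
- move=> x u Su; apply: (E (pe_op al be x (act al be u w))); last exact: Sop.
  by move=> i t; rewrite (actM aP) (act_e aP).
Qed.

(** For natural [s] these are the basis vectors [y^s v] and [y^s f v] of the Verma module; other [s]
    occur only among functions. *)
Definition delta (j : bool) (s : K) : bool -> K -> K :=
  fun i t => ((i == j) && (t == s))%:R.

Definition phi al be u : K := act al be u (delta false 0) false 0.

Local Notation Y := (genY e).
Local Notation F := (genF e).
Local Notation pbw := (pbw e).
Local Notation verma_ideal := (verma_ideal e).

Lemma act_Y al be w j s : act al be Y w j s = w j (s - 1).
Proof. by rewrite (act_e aP) pe_opE /gl2_op; case: j; ring. Qed.

Lemma act_F al be w j s : act al be F w j s = if j then w false s else 0.
Proof. by rewrite (act_e aP) pe_opE /gl2_op; case: j; ring. Qed.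

Lemma act_Yn al be n w j s : act al be (Y ^+ n) w j s = w j (s - n%:R).
Proof.
elim: n s => [|n IH] s; first by rewrite expr0 (act1 aP) subr0.
by rewrite exprS (actM aP) act_Y IH -natr1; congr (w _ _); ring.
Qed.

Lemma act_pbw al be n i : act al be (pbw n i) (delta false 0) = delta i n%:R.
Proof.
apply/funext=> j; apply/funext=> s; rewrite /pbw (actM aP) act_Yn.
have -> : act al be (F ^+ i) (delta false 0) = delta i 0.
  apply/funext=> j'; apply/funext=> t; case: i => /=.
    by rewrite expr1 act_F /delta /=; case: j'.
  by rewrite expr0 (act1 aP).
by rewrite /delta subr_eq0.
Qed.

(** The elements killing [v] form a left ideal, so the generators [e x - weight al be x] suffice. *)
Lemma verma_ideal_act al be u j s :
  verma_ideal al be u -> act al be u (delta false 0) j s = 0.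
Proof.
move=> hu; pose S := [set u : U^o | forall j s, act al be u (delta false 0) j s = 0].
apply: (hu S); split.
  split=> [j' s'|u1 v1 v2 h1 h2 j' s']; first exact: act_0l.
  rewrite (actD aP) h2 addr0 (actM aP) -[RHS](act_0r al be u1 j' s').
  by congr act; apply/funext=> i; apply/funext=> t; apply: h1.
move=> _ [x bx ->] j' s'; rewrite /S /=.
have [a [b [c [d [p [q [r [g ex]]]]]]]] := pe_surj x.
move: bx; rewrite ex => -[]; rewrite /= /pe_mx block_mxKul mxE /= => c0.
rewrite block_mxKdl => /mx2_inj0[_ g0 _ _].
rewrite (actD aP) act_N act_A (act_e aP) pe_opE c0 g0.
rewrite /weight /= /pe_mx block_mxKul !mxE /= /gl2_op /delta.
case: j' => /=; first by ring.
(* Raising reads the function at [s' + 1]; where that is [0], its coefficient contains the vanishing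
   factor [s' + 1]. *)
case: (eqVneq s' 0) => [->|s0] /=; last case: (eqVneq (s' + 1) 0) => [s1|_] /=.
- have -> : ((0 + 1 : K) == 0) = false by rewrite add0r oner_eq0.
  by rewrite /=; ring.
- by rewrite s1; ring.
- by ring.
Qed.

Lemma phi_lin al be k u v : phi al be (k *: u + v) = k * phi al be u + phi al be v.
Proof. by rewrite /phi (actD aP) (actZ aP). Qed.

Lemma phi_pbw al be n i : phi al be (pbw n i) = ((n == 0)%N && ~~ i)%:R.
Proof.
rewrite /phi act_pbw /delta eq_sym [0 == _]eq_sym pnatr_eq0.
by case: i; rewrite ?andbT ?andbF.
Qed.

Local Notation E11 := (e (pe 1 0 0 0 0 0 0 0)).

Lemma E11_Y : E11 * Y = Y * E11 - Y.
Proof.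
rewrite /genY (even_genY eP) //; congr (_ + _).
by rewrite -scaleN1r -(e_scale eP) peZ; congr e; congr pe; ring.
Qed.

Lemma E11_F : E11 * F = F * E11 - F.
Proof. by rewrite even_genF // addr0 scale1r. Qed.

(** Both [Y] and [F] lower the eigenvalue of [E11] by one. *)
Lemma E11_pbw al be n i :
  verma_ideal al be (E11 * pbw n i - (al - (n + i)%:R) *: pbw n i).
Proof.
have b11 : borel (pe 1 0 0 0 0 0 0 0 : pe2 K).
  split; first by rewrite /= /pe_mx block_mxKul mxE.
  by rewrite /= /pe_mx block_mxKdl oppr0 -mx20.
have Yn : E11 * Y ^+ n = Y ^+ n * E11 - n%:R *: Y ^+ n.
  elim: n => [|n IH]; first by rewrite expr0 mul1r mulr1 scale0r subr0.
  rewrite exprS mulrA E11_Y mulrBl -[Y * E11 * _]mulrA IH mulrBr -!scalerAr !mulrA.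
  by rewrite -addrA -opprD  !scaler_nat -mulrSr.
have Fi : E11 * F ^+ i = F ^+ i * E11 - i%:R *: F ^+ i.
  by case: i; rewrite ?expr1 ?scale1r ?E11_F // mul1r mulr1 scale0r subr0.
have Em : E11 * pbw n i = pbw n i * E11 - (n + i)%:R *: pbw n i.
  rewrite /pbw mulrA Yn mulrBl -!mulrA Fi mulrBr -scalerAr -scalerAl.
  by rewrite -addrA -opprD -scalerDl -natrD addnC.
have := verma_idealM (e := e) (pbw n i) (@verma_ideal_borel _ _ e al be _ b11).
rewrite /weight /= /pe_mx block_mxKul !mxE /= mulr0 addr0 mulr1.
congr verma_ideal; rewrite Em mulrBr -scalerAr mulr1 -addrA -opprD -scalerDl.
by congr (_ - _ *: _); ring.
Qed.

(* Kills the vectors of e_11-weight al - 1, ..., al - n and multiplies the highest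
   weight vector by n!; the weight al occurs only there. *)
Fixpoint weight_killer al (n : nat) : U :=
  if n is n'.+1 then (E11 - (al - n%:R)%:A) * weight_killer al n' else 1.

(** On weight [al - m] the factor for [p + 1] acts by [p + 1 - m]. The product is [n!] for [m = 0]
    and zero for [1 <= m <= n]. *)
Lemma weight_killerP al be m n u :
  verma_ideal al be (E11 * u - (al - m%:R) *: u) ->
  verma_ideal al be (weight_killer al n * u
    - (\prod_(p < n) (p.+1%:R - m%:R)) *: u).
Proof.
move=> hu; elim: n => [|n IH].
  by rewrite big_ord0 mul1r scale1r subrr -(scale0r (E11 * u - (al - m%:R) *: u));
    apply: verma_idealZ.
rewrite big_ord_recr /=; set d := \prod_(_ < _) _ in IH *.
set z := E11 - _; rewrite -mulrA.
have -> : z * (weight_killer al n * u) - (d * (n.+1%:R - m%:R)) *: u =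
  z * (weight_killer al n * u - d *: u) + d *: (E11 * u - (al - m%:R) *: u).
  rewrite (mulrBr z) -addrA; congr (_ + _).
  have -> : z * (d *: u) = d *: (E11 * u) - (d * (al - n.+1%:R)) *: u.
    by rewrite /z -scalerAr mulrBl -scalerAl mul1r scalerBr scalerA.
  rewrite opprB scalerBr scalerA addrA subrK -scalerBl -scaleNr.
  by congr (_ *: _); ring.
by apply: verma_idealD; [apply: verma_idealM | apply: verma_idealZ].
Qed.

(** For [n] large enough to reach every weight of [u v], only the component along [v] survives,
    multiplied by [n!]. Both sides being linear in [u], [spansT] reduces this to monomials. *)
Lemma weight_killer_phi al be u : exists n0, forall n, (n0 <= n)%N ->
  verma_ideal al be (weight_killer al n * u - (n`!%:R * phi al be u)%:A).
Proof.
have V0 : verma_ideal al be 0.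
  by move=> I [[]].
apply: (spansT eP (al := al) (be := be) (T := [set u | exists n0, forall n,
  (n0 <= n)%N ->
  verma_ideal al be (weight_killer al n * u - (n`!%:R * phi al be u)%:A)])).
split=> /=.
- move=> u1 u2 [n1 h1] [n2 h2]; exists (maxn n1 n2) => n.
  rewrite geq_max => /andP[/h1 {}h1 /h2 {}h2].
  have := verma_idealD h1 h2; congr verma_ideal.
  rewrite -[u1 in RHS]scale1r phi_lin mul1r scale1r mulrDr mulrDr scalerDl opprD.
  by rewrite addrACA.
- move=> k u1 [n1 h1]; exists n1 => n /h1 /((verma_idealZ k)).
  congr verma_ideal; rewrite -[k *: u1]addr0 phi_lin /phi act_0l -/(phi _ _ _).
  by rewrite !addr0 scalerBr -scalerAr scalerA; congr (_ - _ *: _); ring.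
- move=> v hv; exists 0%N => n _.
  rewrite /phi verma_ideal_act // mulr0 scale0r subr0.
  exact: verma_idealM.
move=> m i; exists (m + i)%N => n hn.
have := weight_killerP n (@E11_pbw al be m i).
set d := \prod_(_ < _) _; rewrite phi_pbw => h.
case: (eqVneq (m + i)%N 0%N) => [mi0|mi0].
  move: (h); have [-> ->] : m = 0%N /\ i = false.
    by move: mi0; case: (m) => //; case: (i).
  rewrite /= !mulr1 /pbw !expr0 mulr1; congr (verma_ideal _ _ (_ - _ *: _)).
  (* The falling factorial lists the factors of [n!] in decreasing order, hence the reversal of the
     index. *)
  rewrite /d mi0 -ffactnn ffact_prod; rewrite natr_prod.
  rewrite [RHS](reindex_inj rev_ord_inj) /=; apply: eq_bigr => p _.
  by rewrite subr0 subKn.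
have -> : ((m == 0)%N && ~~ i) = false by move: mi0; case: (m) => //; case: (i).
rewrite mulr0 scale0r subr0; move: h; rewrite (_ : d = 0) ?scale0r ?subr0 //.
have lt : ((m + i).-1 < n)%N by rewrite prednK // lt0n.
by rewrite /d (bigD1 (Ordinal lt)) //= prednK ?lt0n // subrr mul0r.
Qed.

(** If the coefficient were nonzero, a weight killer would turn [u] into a nonzero scalar modulo the
    Verma ideal, putting [1] into [I]. *)
Lemma proper_phi al be (I : set U^o) u :
  is_submod I -> verma_ideal al be `<=` I -> ~ I 1 -> I u -> phi al be u = 0.
Proof.
move=> [I0 ID] VI I1 Iu; apply: contra_notP I1 => /eqP phi0.
have [n /(_ n (leqnn n))] := weight_killer_phi al be u.
set c := _ * phi _ _ _ => /VI h.
have c0 : c != 0 by rewrite mulf_neq0 // pnatr_eq0 -lt0n fact_gt0.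
have IM a v : I v -> I (a * v) by move=> Iv; rewrite -[a * v]addr0; apply: ID.
have : I c%:A.
  rewrite (_ : c%:A = -1 * (weight_killer al n * u - c%:A) + weight_killer al n * u).
    by apply: ID => //; apply: IM.
  by rewrite mulN1r opprB subrK.
by move/(IM (c^-1)%:A); rewrite -scalerAl mul1r scalerA mulVf // scale1r.
Qed.

End Action.

(** * The annihilator of the simple quotient of a cyclic module *)

Section SimpleQuotient.
Context (R : pzRingType).

Lemma quot_mod_eq0 (V : lmodType R) (A : set V) (v : V) :
  \pi_(quot_mod A) v = 0 <-> submod_gen A v.
Proof.
have -> : 0 = \pi_(quot_mod A) 0 by rewrite pi_zeror.
split=> [/eqP/quot_mod_eqP|h]; first by rewrite subr0.
by apply/eqP/quot_mod_eqP; rewrite subr0.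
Qed.

Lemma quot_modZ (V : lmodType R) (A : set V) a (v : V) :
  a *: \pi_(quot_mod A) v = \pi_(quot_mod A) (a *: v).
Proof. exact: quot_scaleE. Qed.

Lemma quot_modD (V : lmodType R) (A : set V) (u v : V) :
  \pi_(quot_mod A) u + \pi_(quot_mod A) v = \pi_(quot_mod A) (u + v).
Proof. exact: quot_addE. Qed.

Context (G N : set R^o).
Local Notation M := (quot_mod G : lmodType R).
Local Notation L := (quot_mod (@proper_submods R M) : lmodType R).

(** Submodules of [R / G] correspond to left ideals containing [G], among which [N] is the largest
    proper one; hence the iterated quotient [L] is [R / N]. *)
Lemma annihilator_simple_quotient :
  is_submod N -> G `<=` N -> ~ N 1 ->
  (forall I : set R^o, is_submod I -> G `<=` I -> ~ I 1 -> I `<=` N) ->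
  annihilator L = [set u | forall v, N (u * v)].
Proof.
move=> Nsub GN N1 Nmax; have [N0 ND] := Nsub.
have genN : submod_gen G `<=` N by move=> u; apply; split.
have Nrepr (u : R^o) : N (repr (\pi_M u)) <-> N u.
  set u' := repr _.
  have /genN h : submod_gen G (u' - u) by apply/quot_mod_eqP; rewrite reprK.
  split=> hu; last by have := ND 1 _ _ h hu; rewrite scale1r subrK.
  by have := ND (-1) _ _ h hu; rewrite scaleN1r opprB subrK.
pose S : set M := [set x | N (repr x)].
have Ssub : is_submod S.
  split=> [|a x y]; rewrite /S /=.
    have -> : 0 = \pi_M 0 by rewrite pi_zeror.
    by apply/Nrepr.
  rewrite -[x]reprK -[y]reprK quot_modZ quot_modD => /Nrepr hx /Nrepr hy.
  by apply/Nrepr; apply: ND.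
have hS : S <> setT.
  by move=> ST; have /Nrepr : S (\pi_M 1) by rewrite ST.
have max_proper (u : R^o) : submod_gen (@proper_submods R M) (\pi_M u) <-> N u.
  split=> h.
    apply/Nrepr; apply: (h S); split=> // x [T [Tsub TT] Tx]; rewrite /S /=.
    pose I : set R^o := [set u | T (\pi_M u)].
    have [T0 TD] := Tsub.
    have Isub : is_submod I.
      split=> [|a u1 u2 h1 h2]; rewrite /I /=; first by rewrite pi_zeror.
      by rewrite -quot_modD -quot_modZ; apply: TD.
    have GI : G `<=` I.
      move=> v hv; rewrite /I /=; have -> // : \pi_M v = 0.
      by apply/quot_mod_eq0 => ? [_]; apply.
    apply: (Nmax I) => //; last by rewrite /I /= reprK.
    (* A submodule containing the class of [1] is everything. *)
    move=> h1; apply: TT; apply/seteqP; split=> // y _.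
    rewrite -[y]reprK; set v := repr y.
    have := TD v _ _ h1 T0; rewrite addr0 quot_modZ.
    by rewrite (_ : v *: (1 : R^o) = v) // /GRing.scale /= mulr1.
  by move=> T [_ sub]; apply: sub; exists S; rewrite // /S /=; apply/Nrepr.
apply/seteqP; split=> u.
  move=> h v; have := h (\pi_L (\pi_M v)).
  by rewrite quot_modZ quot_modZ => /quot_mod_eq0/max_proper.
move=> h x; rewrite -[x]reprK; set y := repr x; rewrite -[y]reprK.
by rewrite quot_modZ quot_modZ; apply/quot_mod_eq0/max_proper; apply: h.
Qed.

End SimpleQuotient.

(** * Annihilators described by the highest weight coefficient *)

Section Annihilator.
Context (K : numFieldType) (U : algType K) (e : pe2 K -> U).
Context (act : K -> K -> U -> (bool -> K -> K) -> bool -> K -> K).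
Context (eP : is_envelope e) (aP : is_action e act).
Implicit Types (al be : K) (u v : U).
Local Notation phi := (phi act).

Definition annL al be : set U :=
  [set u | forall v v', phi al be (v * u * v') = 0].

(** The largest proper left ideal containing the Verma ideal, by [maxid_max]; its quotient is the
    simple module. *)
Definition maxid al be : set U := [set u | forall v, phi al be (v * u) = 0].

Lemma maxid_lin al be a u v :
  maxid al be u -> maxid al be v -> maxid al be (a * u + v).
Proof.
move=> hu hv v'; rewrite mulrDr mulrA -[_ * _ * _]scale1r (phi_lin aP).
by rewrite hu hv mulr0 addr0.
Qed.

Lemma maxid0 al be : maxid al be 0.
Proof. by move=> v; rewrite mulr0 /phi (act_0l aP). Qed.

Lemma maxid1 al be : ~ maxid al be 1.
Proof.
move=> /(_ 1); rewrite mulr1 /phi (act1 aP) /delta !eqxx => /eqP.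
by rewrite oner_eq0.
Qed.

Lemma maxid_gen al be x : borel x -> maxid al be (e x - (weight al be x)%:A).
Proof.
move=> bx v; rewrite /phi (verma_ideal_act aP) //.
by apply: (verma_idealM (e := e)); apply: verma_ideal_borel.
Qed.

Lemma maxid_max al be (I : set U) :
  I 0 -> (forall a u v, I u -> I v -> I (a * u + v)) -> ~ I 1 ->
  (forall x, borel x -> I (e x - (weight al be x)%:A)) -> I `<=` maxid al be.
Proof.
move=> I0 ID I1 GI u Iu v; apply: (proper_phi eP aP (I := I)) => //.
  by move=> u' hu'; apply: hu'; split=> // _ [x bx ->]; apply: GI.
by rewrite -[v * u]addr0; apply: ID.
Qed.

End Annihilator.

Lemma envelP (K : numFieldType) : is_envelope (@envel K).
Proof. by split; [exact: envel_lin | exact: envel_bracket | exact: enveloping_ind]. Qed.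

Lemma eactP (K : numFieldType) : is_action (@envel K) (@eact K).
Proof.
split; [exact: eactD | exact: eactZ | exact: eactM | exact: eact1 |
  exact: eact_envel | exact: eact_lin].
Qed.

(** An element [u] kills the simple module exactly when [u * v] lies in [maxid] for all [v]. *)
Lemma J_annL (K : numFieldType) (al be : K) : J al be = annL (@eact K) al be.
Proof.
pose G : set (enveloping K)^o :=
  [set u | exists2 x, borel x & u = envel x - (weight al be x)%:A].
pose N : set (enveloping K)^o := maxid (@eact K) al be.
have Nsub : is_submod N.
  split; first exact: maxid0 (@eactP K) al be.
  by move=> a u v; exact: maxid_lin (@eactP K) al be a u v.
have GN : G `<=` N by move=> _ [x bx ->]; exact: maxid_gen (@eactP K) al be x bx.
have N1 : ~ N 1 by exact: maxid1 (@eactP K) al be.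
have Nmax : forall I, is_submod I -> G `<=` I -> ~ I 1 -> I `<=` N.
  move=> I [I0 ID] GI I1; apply: (maxid_max (@envelP K) (@eactP K) I0 ID I1).
  by move=> x bx; apply: GI; exists x.
have -> : J al be = [set u | forall v, N (u * v)].
  exact: (annihilator_simple_quotient Nsub GN N1 Nmax).
apply/seteqP; split=> u h v.
  by move=> v'; rewrite -mulrA; exact: h.
by move=> v'; rewrite mulrA; exact: h.
Qed.

(** * Annihilators of Verma modules and of the module of functions *)

Section Inclusions.
Context (K : numFieldType) (U : algType K) (e : pe2 K -> U).
Context (act : K -> K -> U -> (bool -> K -> K) -> bool -> K -> K).
Context (eP : is_envelope e) (aP : is_action e act).
Implicit Types (al be s t : K) (u v : U) (w : bool -> K -> K) (i j : bool).
Local Notation phi := (phi act).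
Local Notation annL := (annL act).
Local Notation Y := (genY e).
Local Notation F := (genF e).
Local Notation pbw := (pbw e).

(** The right factor in the definition of [annL] matters only modulo the Verma ideal, hence only
    through the basis vectors. *)
Lemma annL_pbw al be u :
  (forall v n i, act al be v (act al be u (delta i n%:R)) false 0 = 0) ->
  annL al be u.
Proof.
move=> h v v'.
apply: (spansT eP (al := al) (be := be) (T := [set v' | phi al be (v * u * v') = 0])).
split=> /= [u1 u2 h1 h2|k u1 h1|u1 h1|n i].
- by rewrite mulrDr -[_ * u1]scale1r (phi_lin aP) h1 h2 mulr0 addr0.
- by rewrite -scalerAr /phi (actZ aP) -/(phi _ _ _) h1 mulr0.
- rewrite /= /phi (actM aP) -[RHS](act_0r aP al be (v * u) false 0).
  by congr act; apply/funext=> i; apply/funext=> t; apply: (verma_ideal_act aP).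
- rewrite /phi (actM aP) (act_pbw aP) (actM aP); exact: h.
Qed.

Lemma annL_act al be u v n i :
  annL al be u -> act al be v (act al be u (delta i n%:R)) false 0 = 0.
Proof.
by move=> /(_ v (pbw n i)); rewrite /phi (actM aP) (act_pbw aP) (actM aP).
Qed.

Definition annW al be : set U :=
  [set u | forall j s, act al be u (delta j s) = fun _ _ => 0].

Lemma annW_annL al be : annW al be `<=` annL al be.
Proof. by move=> u hu; apply: annL_pbw => v n i; rewrite hu (act_0r aP). Qed.

(** Translation by [al - be + 1] intertwines the two actions: it matches the weights and carries the
    zeros [-1] and [al - be] of the raising coefficient to the zeros [(be - 1) - (al + 1)] and [-1]
    of the other one. *)
Lemma annW_shift al be : annW al be `<=` annW (be - 1) (al + 1).
Proof.
move=> u hu j s; set k := al - be + 1.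
have shift w : act (be - 1) (al + 1) u (fun i t => w i (t + k)) =
    fun i t => act al be u w i (t + k).
  move: u {hu}; apply: (e_ind eP) => [|u v hu hv|a u hu|x u hu];
    apply/funext=> i; apply/funext=> t.
  - by rewrite !(act1 aP).
  - by rewrite !(actD aP) hu hv.
  - by rewrite !(actZ aP) hu.
  rewrite !(actM aP) hu !(act_e aP).
  have [a [b [c [d [p [q [r [g ->]]]]]]]] := pe_surj x.
  rewrite !pe_opE /gl2_op.
  have -> : t + 1 + k = t + k + 1 by ring.
  have -> : t - 1 + k = t + k - 1 by ring.
  by rewrite /k; case: i; ring.
have -> : delta j s = fun i t => delta j (s + k) i (t + k).
  apply/funext=> i; apply/funext=> t; rewrite /delta.
  by rewrite (inj_eq (addIr k)).
by rewrite shift hu.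
Qed.

Lemma annW_swap al be : annW al be = annW (be - 1) (al + 1).
Proof.
apply/seteqP; split; first exact: annW_shift.
by move=> u /annW_shift; rewrite addrK subrK.
Qed.

Lemma gl2_op_poly al be a b c d (P0 P1 P2 : {poly K}) (n : int) :
  exists Q : {poly K}, forall (h : K -> K) s,
    h (s + n%:~R) = P0.[s] -> h (s + (n + 1)%:~R) = P1.[s] ->
    h (s + (n - 1)%:~R) = P2.[s] ->
    gl2_op al be a b c d h (s + n%:~R) = Q.[s].
Proof.
exists ((a *: ((al - n%:~R)%:P - 'X) + d *: ((be + n%:~R)%:P + 'X)) * P0
  + (b *: (('X + (n%:~R + 1)%:P) * ((al - be - n%:~R)%:P - 'X))) * P1 + c *: P2).
move=> h s h0; rewrite intrB intrD !addrA => h1 h2; rewrite /gl2_op h0 h1 h2.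
rewrite !(hornerD, hornerM, hornerZ, hornerN, hornerX, hornerC).
by move: (n%:~R) => m; ring.
Qed.

(** The offset [n] is fixed while [s] varies. A generator mixes the offsets [n - 1], [n] and
    [n + 1], so the induction over [u] is for all [n]. *)
Lemma act_poly al be u i j (n : int) :
  exists P : {poly K}, forall s, act al be u (delta i s) j (s + n%:~R) = P.[s].
Proof.
move: u j n; apply: (e_ind eP) => [|u v hu hv|k u hu|x u hu] j n.
- exists ((j == i) && (n == 0))%:R => s; rewrite (act1 aP) /delta.
  rewrite -[s + _ == s]subr_eq0 addrAC subrr add0r intr_eq0.
  by case: (_ && _); rewrite hornerE.
- have [P hP] := hu j n; have [Q hQ] := hv j n.
  by exists (P + Q) => s; rewrite (actD aP) hP hQ hornerE.
- have [P hP] := hu j n.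
  by exists (k *: P) => s; rewrite (actZ aP) hP hornerE.
have [a [b [c [d [p [q [r [g ->]]]]]]]] := pe_surj x.
have [P0 h0] := hu true n; have [P1 h1] := hu true (n + 1).
have [P2 h2] := hu true (n - 1); have [Q0 g0] := hu false n.
have [Q1 g1] := hu false (n + 1); have [Q2 g2] := hu false (n - 1).
case: j.
  have [R hR] := gl2_op_poly (al - 1) (be - 1) a b c d P0 P1 P2 n.
  by exists (R + g *: Q0) => s; rewrite (actM aP) (act_e aP) pe_opE (hR _ s) // g0 !hornerE.
have [R hR] := gl2_op_poly al be a b c d Q0 Q1 Q2 n.
have [R' hR'] := gl2_op_poly al be (- q) p (- r) q P0 P1 P2 n.
by exists (R + R') => s; rewrite (actM aP) (act_e aP) pe_opE (hR _ s) // (hR' _ s) // !hornerE.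
Qed.

Lemma act_support al be u i j s t :
  (forall n : int, t <> s + n%:~R) -> act al be u (delta i s) j t = 0.
Proof.
move=> ht.
pose S : set (bool -> K -> K) :=
  [set w | forall j t, (forall n : int, t <> s + n%:~R) -> w j t = 0].
apply: (act_stable eP aP (S := S)) => // [k w w' h h' j' t' ht'|x w h j' t' ht'|j' t' ht'].
- by rewrite h // h' // mulr0 addr0.
- have [a [b [c [d [p [q [r [g ->]]]]]]]] := pe_surj x.
  have hp : forall n : int, t' + 1 <> s + n%:~R.
    by move=> n /(canRL (addrK _)) E; apply: (ht' (n - 1)); rewrite E intrB addrA.
  have hm : forall n : int, t' - 1 <> s + n%:~R.
    by move=> n /(canRL (subrK _)) E; apply: (ht' (n + 1)); rewrite E intrD addrA.
  by rewrite pe_opE /gl2_op !(h _ t') // !(h _ (t' + 1)) // !(h _ (t' - 1)) //;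
    case: j'; ring.
- rewrite /delta; case: (t' =P s) => [E|]; last by rewrite andbF.
  by case: (ht' 0); rewrite E addr0.
Qed.

(** Naturals are distinct in characteristic zero, so there are too many roots; the threshold [n0]
    leaves room for negative offsets. *)
Lemma poly_nat_roots (P : {poly K}) (n0 : nat) :
  (forall n : nat, (n0 <= n)%N -> P.[n%:R] = 0) -> P = 0.
Proof.
move=> h; apply: (roots_geq_poly_eq0 (rs := [seq n%:R | n <- iota n0 (size P)])).
- apply/allP=> r /mapP[n]; rewrite mem_iota => /andP[hn _] ->.
  by apply/rootP; apply: h.
- by rewrite map_inj_uniq ?iota_uniq // => m n /eqP; rewrite eqr_nat => /eqP.
- by rewrite size_map size_iota.
Qed.

(* In other words, some v moves a nonzero vector of the Verma module to the
   highest weight line. *)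
Lemma lowest_coef al be w : (forall n : nat, al - be != n%:R) ->
  (forall v, act al be v w false 0 = 0) -> forall j (n : nat), w j n%:R = 0.
Proof.
move=> kN hw.
have natS (n : nat) : (n%:R + 1 : K) != 0 by rewrite natr1 pnatr_eq0.
have subk (n : nat) : al - be - n%:R != 0 by rewrite subr_eq0.
have even w' : (forall v, act al be v w' false 0 = 0) ->
    forall n : nat, w' false n%:R = 0.
  move=> hw' n; elim: n w' hw' => [|n IH] w' hw'.
    by have := hw' 1; rewrite (act1 aP).
  (* Raising moves the coefficient at [n + 1] to [n] with the factor [(n + 1) * (al - be - n)],
     nonzero by [kN]. *)
  have : act al be (e (pe 0 1 0 0 0 0 0 0)) w' false n%:R = 0.
    by apply: IH => v; rewrite -(actM aP); apply: hw'.
  rewrite (act_e aP) pe_opE /gl2_op natr1 !(mul0r, mulr0, oppr0, add0r, addr0, mul1r).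
  by move/eqP; rewrite !mulf_eq0 -natr1 (negPf (natS n)) (negPf (subk n)) => /eqP.
move=> [] n; last exact: even.
case: n => [|n].
  (* The odd coefficients are carried to even ones by g_1: at index [0] the element with [q = 1] has
     the factor [be - al], and beyond it the one with [p = 1] has the raising factor. *)
  have := hw (e (pe 0 0 0 0 0 1 0 0)).
  rewrite (act_e aP) pe_opE /gl2_op !(mul0r, mulr0, oppr0, add0r, addr0, mul1r).
  rewrite mulN1r => /eqP; rewrite mulf_eq0 addrC subr_eq0 eq_sym -subr_eq0.
  by rewrite (negPf (kN 0%N)) => /eqP.
have : act al be (e (pe 0 0 0 0 1 0 0 0)) w false n%:R = 0.
  by apply: even => v; rewrite -(actM aP); apply: hw.
rewrite (act_e aP) pe_opE /gl2_op natr1 !(mul0r, mulr0, oppr0, add0r, addr0, mul1r).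
by move/eqP; rewrite !mulf_eq0 -natr1 (negPf (natS n)) (negPf (subk n)) => /eqP.
Qed.

(* The matrix coefficients are polynomial in the index, so that vanishing on the
   Verma module, whose indices are the natural numbers, is vanishing. *)
Lemma annL_annW al be : (forall n : nat, al - be != n%:R) ->
  annL al be `<=` annW al be.
Proof.
move=> kN u hu i s; apply/funext=> j; apply/funext=> t.
have h0 (n m : nat) i' j' : act al be u (delta i' n%:R) j' m%:R = 0.
  by apply: (lowest_coef kN) => v; apply: annL_act.
case: (pselect (exists n : int, t = s + n%:~R)) => [[n ->]|ht]; last first.
  by apply: act_support => n E; apply: ht; exists n.
have [P hP] := act_poly al be u i j n.
(* From [|n|] on, [m + n] is a natural number, so [h0] applies. *)
rewrite hP (_ : P = 0) ?horner0 //; apply: (poly_nat_roots (n0 := `|n|%N)) => m hm.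
rewrite -hP (_ : m%:R + n%:~R = (absz (m%:Z + n))%:R) //.
by rewrite !pmulrn -intrD; congr (_%:~R); lia.
Qed.

End Inclusions.

(** * The one-dimensional subquotient, and obstructions to inclusion *)

Section Noninclusions.
Context (K : numFieldType) (U : algType K) (e : pe2 K -> U).
Context (act : K -> K -> U -> (bool -> K -> K) -> bool -> K -> K).
Context (eP : is_envelope e) (aP : is_action e act).
Implicit Types (al be s t : K) (u v : U) (w : bool -> K -> K) (i j : bool).
Local Notation phi := (phi act).
Local Notation annL := (annL act).
Local Notation annW := (annW act).
Local Notation Y := (genY e).
Local Notation F := (genF e).

Definition nonneg_supp : set (bool -> K -> K) :=
  [set w | forall j (n : nat), w j (- n.+1%:R) = 0].

(** Only raising could lead from index [0] to [-1], and its coefficient there has the factor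
    [s + 1]. *)
Lemma nonneg_supp_act al be u w :
  nonneg_supp w -> nonneg_supp (act al be u w).
Proof.
apply: (act_stable eP aP) => [k w1 w2 h1 h2 j n|x w1 h j n].
  by rewrite h1 h2 mulr0 addr0.
have [a [b [c [d [p [q [r [g ->]]]]]]]] := pe_surj x.
rewrite pe_opE /gl2_op -opprD natr1 !h.
by case: n j => [|n] [];
  rewrite ?addNr -1?[n.+2%:R]natr1 ?opprD ?subrK ?h; ring.
Qed.

Lemma nonneg_supp_delta j : nonneg_supp (delta j 0).
Proof. by move=> i n; rewrite /delta oppr_eq0 pnatr_eq0 andbF. Qed.

(** For equal parameters nothing leads back to [v]: raising into index [0] has the factor
    [al - be - s = 0], and g_1 sends [f v] to a multiple of [(al - be) v]. *)
Lemma odd_supp_act al u w :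
  nonneg_supp w /\ w false 0 = 0 ->
  nonneg_supp (act al al u w) /\ act al al u w false 0 = 0.
Proof.
move: u w; apply: (act_stable eP aP
  (S := [set w | nonneg_supp w /\ w false 0 = 0])).
  move=> k w1 w2 [h1 h10] [h2 h20]; split; last by rewrite h10 h20 mulr0 addr0.
  by move=> j n; rewrite h1 h2 mulr0 addr0.
move=> x w [h h0]; split.
  have E : act al al (e x) w = pe_op al al x w.
    by apply/funext=> i; apply/funext=> t; rewrite (act_e aP).
  by rewrite -E; apply: nonneg_supp_act.
have [a [b [c [d [p [q [r [g ->]]]]]]]] := pe_surj x.
have := (h false 0%N, h true 0%N); rewrite mulr1n => -[hf ht].
by rewrite pe_opE /gl2_op h0 sub0r hf ht; ring.
Qed.

(* In the Verma module of weight (al, al), the vector f v spans a one-dimensional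
   subquotient of weight (al - 1, al - 1). *)
Lemma phi_bottom al u :
  phi (al - 1) (al - 1) u = act al al u (delta true 0) true 0.
Proof.
rewrite /phi; move: u; apply: (e_ind eP) => [|u v hu hv|k u hu|x u hu].
- by rewrite !(act1 aP).
- by rewrite !(actD aP) hu hv.
- by rewrite !(actZ aP) hu.
rewrite !(actM aP) !(act_e aP).
have h := @nonneg_supp_act (al - 1) (al - 1) u _ (nonneg_supp_delta false).
have [|h' h0] := @odd_supp_act al u (delta true 0).
  by split; [apply: nonneg_supp_delta | rewrite /delta].
(* Both sides get multiplied by [(a + d) * (al - 1)]; every other contribution vanishes. *)
have := (h false 0%N, h true 0%N, h' true 0%N); rewrite mulr1n => -[[hf ht] ht'].
have [a [b [c [d [p [q [r [g ->]]]]]]]] := pe_surj x.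
by rewrite !pe_opE /gl2_op sub0r hf ht ht' h0 hu; ring.
Qed.

(** By [phi_bottom] the coefficients defining the right-hand side are coefficients of the action
    with parameters [(al, al)] on [delta true 0]. *)
Lemma annW_bottom al : annW al al `<=` annL (al - 1) (al - 1).
Proof.
move=> u hu; apply: (annL_pbw eP aP) => v n i.
rewrite -(act_pbw aP (al - 1) (al - 1)) -!(actM aP) -/(phi _ _ _) phi_bottom !(actM aP).
have -> : act al al (pbw e n i) (delta true 0) =
    if i then (fun _ _ => 0) else delta true n%:R.
  apply/funext=> j; apply/funext=> t; rewrite /pbw (actM aP) (act_Yn aP).
  case: i => /=; first by rewrite expr1 (act_F aP) /delta; case: j.
  by rewrite expr0 (act1 aP) /delta subr_eq0.
rewrite (_ : act al al u _ = fun _ _ => 0) ?(act_0r aP) //.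
case: i; last exact: hu.
by apply/funext=> j; apply/funext=> t; rewrite (act_0r aP).
Qed.

Definition trace_elt : U := e (pe 1 0 0 1 0 0 0 0).

Definition casimir : U :=
  4%:R *: (Y * e (pe 0 1 0 0 0 0 0 0))
  + e (pe 1 0 0 (-1) 0 0 0 0) * e (pe 1 0 0 (-1) 0 0 0 0)
  + 2%:R *: e (pe 1 0 0 (-1) 0 0 0 0).

Lemma act_trace al be w j s :
  act al be trace_elt w j s = (al + be - 2%:R *+ j) * w j s.
Proof. by rewrite (act_e aP) pe_opE /gl2_op; case: j => /=; ring. Qed.

(** The odd half has parameters [(al - 1, be - 1)] with the same difference, so the Casimir element
    of gl(2) acts by one scalar on both halves. *)
Lemma act_casimir al be w j s :
  act al be casimir w j s = (al - be) * (al - be + 2%:R) * w j s.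
Proof.
rewrite /casimir !(actD aP) !(actZ aP) !(actM aP) (act_Y aP) !(act_e aP) !pe_opE.
by case: j; rewrite /gl2_op !(act_e aP) !pe_opE /gl2_op subrK; ring.
Qed.

Lemma casimir_annL al be :
  annL al be (casimir - ((al - be) * (al - be + 2%:R))%:A).
Proof.
apply: (annW_annL eP aP) => i s; apply/funext=> j; apply/funext=> t.
by rewrite (actD aP) (act_N aP) (act_A aP) act_casimir subrr.
Qed.

Lemma act_trace_shift al be c w j s :
  act al be (trace_elt - c%:A) w j s = (al + be - 2%:R *+ j - c) * w j s.
Proof. by rewrite (actD aP) (act_N aP) (act_A aP) act_trace; ring. Qed.

(** Its roots are the two trace eigenvalues, on the even and on the odd half. *)
Definition trace_quad al be : U :=
  (trace_elt - (al + be)%:A) * (trace_elt - (al + be - 2%:R)%:A).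

Lemma act_trace_quad al be al' be' w j s :
  act al' be' (trace_quad al be) w j s =
  (al' + be' - 2%:R *+ j - (al + be)) *
  (al' + be' - 2%:R *+ j - (al + be) + 2%:R) * w j s.
Proof. by rewrite (actM aP) !act_trace_shift; ring. Qed.

Lemma trace_annL al be : annL al be (trace_quad al be).
Proof.
apply: (annW_annL eP aP) => i s; apply/funext=> j; apply/funext=> t.
by rewrite act_trace_quad; case: j => /=; ring.
Qed.

(** For equal parameters the odd half lies in the maximal submodule by [odd_supp_act], so one trace
    eigenvalue is left and a linear factor suffices. *)
Lemma trace_annL_diag al : annL al al (trace_elt - (al + al)%:A).
Proof.
apply: (annL_pbw eP aP) => v n i.
have h0 : nonneg_supp (delta i n%:R).
  move=> j m; have E : (- m.+1%:R == n%:R :> K) = false.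
    by rewrite -subr_eq0 -opprD oppr_eq0 -natrD pnatr_eq0.
  by rewrite /delta E andbF.
have E : act al al (trace_elt - (al + al)%:A) (delta i n%:R) =2
    (fun j t => - 2%:R *+ i * delta i n%:R j t).
  move=> j t; rewrite act_trace_shift /delta.
  by case: (eqVneq j i) => [->|_] /=; case: i {h0} => /=; ring.
rewrite (act_wext act al al v E) (act_Zr aP).
case: i h0 {E} => h0; last by rewrite mulr0n mul0r.
have [|_ ->] := @odd_supp_act al v (delta true n%:R); last by rewrite mulr0.
by split; last rewrite /delta.
Qed.

Lemma annL_phi al be u : annL al be u -> phi al be u = 0.
Proof. by move=> /(_ 1 1); rewrite mul1r mulr1. Qed.

(** The element of g_1 with [q = 1] sends [f v] to [(be - al) v], so [f v] survives in the simple
    quotient unless [al = be]. *)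
Lemma annL_odd al be u c : annL al be u ->
  (forall j t, act al be u (delta true 0) j t = c * delta true 0 j t) ->
  c * (al - be) = 0.
Proof.
move=> hu hc.
have := @annL_act _ _ _ _ aP al be u (e (pe 0 0 0 0 0 1 0 0)) 0 true hu.
rewrite (act_wext act al be _ hc) (act_Zr aP) (act_e aP) pe_opE /gl2_op /delta.
rewrite /= eqxx /= => /eqP; rewrite mulf_eq0 => /orP[/eqP->|/eqP h]; first by rewrite mul0r.
by rewrite (_ : al - be = 0) ?mulr0 // -[RHS]oppr0 -[in RHS]h; ring.
Qed.

Lemma annL_sub_casimir al be al' be' : annL al be `<=` annL al' be' ->
  (al - be) * (al - be + 2%:R) = (al' - be') * (al' - be' + 2%:R).
Proof.
move=> /(_ _ (casimir_annL al be))/annL_phi; rewrite /phi (actD aP) (act_N aP).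
rewrite (act_A aP) act_casimir /delta !eqxx /= !mulr1 => /eqP.
by rewrite subr_eq0 => /eqP.
Qed.

Lemma annL_sub_trace al be al' be' : annL al be `<=` annL al' be' ->
  al' + be' = al + be \/ al' = be' /\ al' + be' = al + be - 2%:R.
Proof.
move=> /(_ _ (trace_annL al be)) h.
have := annL_phi h; rewrite /phi act_trace_quad /delta !eqxx mulr0n subr0 mulr1.
move=> /eqP; rewrite mulf_eq0 subr_eq0 => /orP[/eqP|]; first by left.
move=> /eqP e1; right.
have es : al' + be' = al + be - 2%:R.
  by rewrite -[LHS]subr0 -[in LHS]e1; ring.
(* On [f v] the trace is now [al + be - 4], where the quadratic takes the value
   [(-4) * (-2) = 8]. *)
split=> //; have : 8%:R * (al' - be') = 0.
  by apply: (annL_odd h) => j t; rewrite act_trace_quad es /delta; case: j => /=; ring.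
by move=> /eqP; rewrite mulf_eq0 pnatr_eq0 subr_eq0 => /eqP.
Qed.

Lemma annL_sub_diag al al' be' : annL al al `<=` annL al' be' ->
  al' = al /\ be' = al.
Proof.
move=> /(_ _ (trace_annL_diag al)) h.
have := annL_phi h; rewrite /phi act_trace_shift /delta !eqxx mulr0n subr0 mulr1.
move=> /eqP; rewrite subr_eq0 => /eqP es.
have : - 2%:R * (al' - be') = 0.
  by apply: (annL_odd h) => j t; rewrite act_trace_shift es /delta; case: j => /=; ring.
move=> /eqP; rewrite mulf_eq0 oppr_eq0 pnatr_eq0 subr_eq0 => /eqP E.
move: es; rewrite E -!mulr2n => /eqP; rewrite -subr_eq0 -mulrnBl mulrn_eq0 subr_eq0.
by move=> /eqP ->.
Qed.

(** Equal traces and Casimir values leave only the pair itself and its swap; the other trace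
    eigenvalue forces [al' = be'], hence Casimir value zero. *)
Lemma annL_sub al be al' be' : annL al be `<=` annL al' be' ->
  [\/ al' = al /\ be' = be,
      [/\ al != be, al' = be - 1 & be' = al + 1]
    | [/\ be = al + 2%:R, al' = al & be' = al] ].
Proof.
move=> sub; case: (eqVneq al be) => [E|ne].
  by move: sub; rewrite -E => /annL_sub_diag[-> ->]; constructor 1.
have cas := annL_sub_casimir sub.
have double0 (z : K) : z + z = 0 -> z = 0.
  by move/eqP; rewrite -mulr2n mulrn_eq0 => /eqP.
case: (annL_sub_trace sub) => [es|[E es]].
  (* With equal traces, the difference of the Casimir values is [-4] times this product. *)
  have /eqP : (al' - al) * (al' + 1 - be) = 0.
    have h4 : (al - be) * (al - be + 2%:R) - (al' - be') * (al' - be' + 2%:R) = 0.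
      by rewrite cas subrr.
    have Ebe : be' = al + be - al' by rewrite -es addrAC subrr add0r.
    move: h4; rewrite Ebe => h4; apply/double0/double0.
    by rewrite -[RHS]oppr0 -[in RHS]h4; ring.
  rewrite mulf_eq0 => /orP[/eqP h|/eqP h].
    have h1 : al' = al by apply/eqP; rewrite -subr_eq0 h.
    by constructor 1; split=> //; move: es; rewrite h1 => /addrI.
  have h1 : al' = be - 1 by apply/eqP; rewrite -subr_eq0 opprB addrA h.
  by constructor 2; split=> //; apply: (addrI al'); rewrite es h1; ring.
have h2 : al - be + 2%:R = 0.
  move: cas; rewrite E subrr mul0r => /eqP.
  by rewrite mulf_eq0 subr_eq0 (negPf ne) => /eqP.
have h3 : be = al + 2%:R by rewrite -[LHS]addr0 -h2; ring.
have h4 : al' = al.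
  rewrite -E h3 in es; apply/eqP; rewrite -subr_eq0; apply/eqP; apply: double0.
  by rewrite addrACA es; ring.
by constructor 3; rewrite -E h4.
Qed.

(** The power moves every basis vector beyond index [n]. Functions vanishing at all integers up to
    [n] form a submodule, since the raising coefficient is zero at [s = n]; in particular index [0]
    is never reached. *)
Lemma annL_pow al be (n : nat) : al - be = n%:R -> annL al be (Y ^+ n.+1).
Proof.
move=> k; apply: (annL_pbw eP aP) => v m i.
have E : act al be (Y ^+ n.+1) (delta i m%:R) =2 delta i (m + n.+1)%:R.
  by move=> j t; rewrite (act_Yn aP) /delta natrD subr_eq.
pose S : set (bool -> K -> K) :=
  [set w | forall j (p : nat), w j (n%:R - p%:R) = 0].
have S0 : S (delta i (m + n.+1)%:R).
  move=> j p; rewrite /delta.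
  have -> : (n%:R - p%:R == (m + n.+1)%:R :> K) = false; last by rewrite andbF.
  by rewrite subr_eq -natrD eqr_nat; apply/negP => /eqP; lia.
have Slin c w w' : S w -> S w' -> S (fun j t => c * w j t + w' j t).
  by move=> h h' j p; rewrite h h' mulr0 addr0.
have Sop x w : S w -> S (pe_op al be x w).
  move=> h j p.
  have [a [b [c [d [p' [q [r [g ->]]]]]]]] := pe_surj x.
  have hm i' : w i' (n%:R - p%:R - 1) = 0 by rewrite -addrA -opprD natr1 h.
  have hp i' : (al - be - (n%:R - p%:R)) * w i' (n%:R - p%:R + 1) = 0.
    case: p {hm} => [|p]; first by rewrite k subr0 subrr mul0r.
    have -> : n%:R - p.+1%:R + 1 = n%:R - p%:R :> K by rewrite -natr1; ring.
    by rewrite h mulr0.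
  rewrite pe_opE /gl2_op !h !hm.
  have k1 : al - 1 - (be - 1) = al - be by ring.
  by case: j; rewrite ?k1 -!mulrA ?hp; ring.
by have := act_stable eP aP Slin Sop v S0 false n; rewrite subrr (act_wext _ _ _ _ E).
Qed.

(** Here [annL] lies in [annW], whereas the power sends [delta false 0] to [delta false n]. *)
Lemma annL_not_pow al be (n : nat) : (forall m : nat, al - be != m%:R) ->
  ~ annL al be (Y ^+ n).
Proof.
move=> kN /(annL_annW eP aP kN) /(_ false 0) /(congr1 (fun w => w false n%:R)).
rewrite (act_Yn aP) subrr /delta !eqxx => /eqP; rewrite oner_eq0 //.
Qed.

End Noninclusions.

(** * Connected components of an inclusion order *)

Section InclusionOrderComponents.
Context (T : Type) (X : set (set T)).

Lemma comparable_in_sym P Q : comparable_in X P Q -> comparable_in X Q P.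
Proof. by move=> [XP XQ h]; split=> //; case: h; [right | left]. Qed.

Lemma connected_sym P Q :
  clos_refl_trans _ (comparable_in X) P Q -> clos_refl_trans _ (comparable_in X) Q P.
Proof.
elim=> [P' Q' h|P'|P' Q' S' _ h1 _ h2].
- exact/rt_step/comparable_in_sym.
- exact: rt_refl.
- exact: rt_trans h2 h1.
Qed.

(** Closure under comparability keeps every path inside [C], and any two members are joined through
    [P]. *)
Lemma component_eq (C : set (set T)) P :
  C `<=` X -> (forall Q S, C Q -> comparable_in X Q S -> C S) ->
  (forall Q, C Q -> clos_refl_trans _ (comparable_in X) P Q) ->
  forall Q, C Q -> [set S | X S /\ clos_refl_trans _ (comparable_in X) Q S] = C.
Proof.
move=> CX Ccl Ccon Q CQ; apply/seteqP; split=> S.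
  by case=> _ h; elim: h CQ => [P' Q' h|//|P' Q' S' _ h1 _ h2] CP';
    [apply: Ccl h | apply/h2/h1].
move=> CS; split; first exact: CX.
by apply: rt_trans (Ccon _ CS); apply/connected_sym/Ccon.
Qed.

End InclusionOrderComponents.

(** * Components and Hasse diagram, deduced from four inclusion properties of [J] *)

Section Classification.
Context (K : numFieldType) (T : Type) (J : K -> K -> set T).
Implicit Types (a b : K) (i j : int).

Context (sub_swap : forall a b, (forall n : nat, a - b != n%:R) ->
  J a b `<=` J (b - 1) (a + 1)).
Context (sub_bottom : forall a, J a (a + 2%:R) `<=` J a a).
Context (sub_inv : forall a b a' b', J a b `<=` J a' b' ->
  [\/ a' = a /\ b' = b, [/\ a != b, a' = b - 1 & b' = a + 1]
    | [/\ b = a + 2%:R, a' = a & b' = a] ]).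
Context (nsub_swap : forall a b (n : nat), a - b = n%:R ->
  ~ J a b `<=` J (b - 1) (a + 1)).

Local Notation X := [set I | exists a b, I = J a b].
Local Notation D a i := (J (a + i%:~R) (a + i%:~R)).
Local Notation E a i := (J (a + i%:~R) (a + i%:~R + 2)).
Local Notation integral z := (exists n : int, z = n%:~R).

Lemma absurd_eq (n : nat) (x y : K) : x = y -> x - y = n.+1%:R -> False.
Proof. by move=> ->; rewrite subrr => /esym/eqP; rewrite pnatr_eq0. Qed.

Lemma addI_int a i j : a + i%:~R = a + j%:~R -> i = j.
Proof. by move/addrI/eqP; rewrite eqr_int => /eqP. Qed.

Lemma swap_eq a b : ~ integral (a - b) -> J a b = J (b - 1) (a + 1).
Proof.
move=> ni; apply/seteqP; split.
  by apply: sub_swap => n; apply/eqP => e; apply: ni; exists n.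
(* The swap is an involution, and the swapped pair has difference [-(a - b) - 2], again not an
   integer. *)
rewrite [X in _ `<=` X](_ : _ = J (a + 1 - 1) (b - 1 + 1)); last by congr J; ring.
apply: sub_swap => n; apply/eqP => e; apply: ni; exists (- n%:Z - 2).
rewrite intrB intrN -[n%:~R]e; ring.
Qed.

(** The difference on the left is [-(k + 2)], never a natural number. The case [k = 0] gives half of
    the zigzag edges. *)
Lemma swap_proper a (k : nat) : J (a - 1) (a + k%:R + 1) `<` J (a + k%:R) a.
Proof.
split.
  rewrite [X in _ `<=` X](_ : _ = J (a + k%:R + 1 - 1) (a - 1 + 1)); last by congr J; ring.
  apply: sub_swap => n; apply/eqP => e.
  by apply: (@absurd_eq (n + k + 1) 0 0) => //; rewrite subrr -natr1 !natrD -e; ring.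
by apply: nsub_swap; rewrite addrC addKr.
Qed.

Lemma zig_subl a i : E a i `<=` D a i. Proof. exact: sub_bottom. Qed.

Lemma zig_subr a i : E a i `<=` D a (i + 1).
Proof.
have := (swap_proper (a + i%:~R + 1) 0).1.
by congr (J _ _ `<=` J _ _); rewrite ?intrD; ring.
Qed.

Lemma zig_DD a i a' b' : D a i `<=` J a' b' -> a' = a + i%:~R /\ b' = a + i%:~R.
Proof.
case/sub_inv=> [[-> ->] //|[]|[e _ _]]; first by rewrite eqxx.
by case: (@absurd_eq 1 _ _ (esym e)); ring.
Qed.

Lemma zig_ED a i a' b' : E a i `<=` J a' b' ->
  [\/ J a' b' = E a i, J a' b' = D a i | J a' b' = D a (i + 1)].
Proof.
case/sub_inv=> [[-> ->]|[_ -> ->]|[_ -> ->]]; first by constructor 1.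
  by constructor 3; congr J; rewrite intrD; ring.
by constructor 2.
Qed.

Lemma zig_D_inj a i j : D a i `<=` D a j -> i = j.
Proof. by case/zig_DD => /addI_int. Qed.

Lemma zig_DE a i j : ~ D a i `<=` E a j.
Proof. by case/zig_DD => -> e; apply: (@absurd_eq 1 _ _ e); ring. Qed.

Lemma zig_E_inj a i j : E a i `<=` E a j -> i = j.
Proof.
case/sub_inv=> [[/addI_int //]|[_ e1 e2]|[_ e1 e2]].
  by case: (@absurd_eq 1 _ _ e2); rewrite e1; ring.
by case: (@absurd_eq 1 _ _ e2); rewrite e1; ring.
Qed.

Local Notation Z a := [set I | exists i : int, I = D a i \/ I = E a i].
Local Notation edge a := (fun P Q => exists i : int, P = J (a + i%:~R - 1) (a + i%:~R + 1) /\
  (Q = J (a + i%:~R - 1) (a + i%:~R - 1) \/ Q = D a i)).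

(** A shift of index: the edges of the zigzag at [i] have the lower ideal [E a (i - 1)]. *)
Lemma edgeP a P Q :
  edge a P Q <-> exists i, P = E a i /\ (Q = D a i \/ Q = D a (i + 1)).
Proof.
split=> -[i [-> h]].
  exists (i - 1); rewrite subrK; split; first by congr J; rewrite intrB; ring.
  by case: h => ->; [left | right]; congr J; rewrite ?intrB; ring.
exists (i + 1); split; first by congr J; rewrite intrD; ring.
by case: h => ->; [left | right] => //; congr J; rewrite intrD; ring.
Qed.

Lemma zig_sub a P Q : Z a P -> Z a Q -> P `<=` Q -> P = Q \/ edge a P Q.
Proof.
move=> [i [] ->] [j [] ->] h.
- by left; rewrite (zig_D_inj h).
- by case: (zig_DE h).
- right; apply/edgeP; exists i; split=> //.
  by case: (zig_ED h) => [e|->|->]; [| left | right] => //; case: (@zig_DE a j i); rewrite e.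
- by left; rewrite (zig_E_inj h).
Qed.

Lemma edge_sub a P Q : edge a P Q -> P `<=` Q.
Proof. by move/edgeP=> [i [-> [] ->]]; [apply: zig_subl | apply: zig_subr]. Qed.

Lemma zig_hasse a : is_hasse_diagram (Z a) (edge a).
Proof.
split=> P Q.
  split=> [[ZP ZQ [PQ QP] _]|ePQ].
    by case: (zig_sub ZP ZQ PQ) => // e; case: QP; rewrite e.
  have PQ := edge_sub ePQ; move/edgeP: ePQ => [i [eP eQ]].
  have [j eQj] : exists j, Q = D a j by case: eQ => ->; eexists.
  have ZP : Z a P by exists i; right.
  have ZQ : Z a Q by exists j; left.
  split=> //; first by split=> //; rewrite eP eQj => /zig_DE.
  move=> [S [ZS [PS SP] [SQ QS]]].
  (* An ideal strictly above [P] is diagonal, and distinct diagonal ideals are incomparable. *)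
  case: (zig_sub ZP ZS PS) => [e|/edgeP[i1 [_ eS]]]; first by case: SP; rewrite e.
  have [l eSl] : exists l, S = D a l by case: eS => ->; eexists.
  by case: QS; move: SQ; rewrite eSl eQj => /zig_D_inj ->.
move=> ZP ZQ; split=> [PQ|].
  by case: (zig_sub ZP ZQ PQ) => [->|h]; [apply: rt_refl | apply: rt_step].
by elim=> [P' Q' /edge_sub|P'|P' Q' S' _ h1 _ h2] // x /h1/h2.
Qed.

Lemma J_X a b : X (J a b). Proof. by exists a, b. Qed.
#[local] Hint Resolve J_X : core.

Notation crt := (clos_refl_trans _ (comparable_in X)).

Lemma crt_sub a b a' b' : J a b `<=` J a' b' -> crt (J a b) (J a' b').
Proof. by move=> h; apply: rt_step; split=> //; left. Qed.

Lemma comparable_cases a b (S : set T) : comparable_in X (J a b) S ->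
  exists a' b', S = J a' b' /\
  (J a b `<=` J a' b' \/ J a' b' `<=` J a b).
Proof. by move=> [_ [a' [b' ->]] h]; exists a', b'. Qed.

Lemma component_generic a b Q : ~ integral (a - b) ->
  [set J a b; J (b - 1) (a + 1)] Q ->
  [set S | X S /\ crt Q S] = [set J a b; J (b - 1) (a + 1)].
Proof.
move=> ni; rewrite -swap_eq // setUid => ->.
apply: (component_eq (P := J a b)) => [_ ->|_ S ->|_ ->|] //; last exact: rt_refl.
move=> /comparable_cases[a' [b' [-> [] /sub_inv]]] /=.
- case=> [[-> ->] //|[_ -> ->]|[e _ _]]; first by rewrite -swap_eq.
  by case: ni; exists (- 2%:Z); rewrite e intrN; ring.
- case=> [[-> ->] //|[_ ea eb]|[e ea eb]].
    by rewrite (swap_eq ni) eb ea; congr J; ring.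
  by case: ni; exists 0; rewrite ea eb subrr.
Qed.

(** The swap fixes [(a, a + 1)], and a difference of [-1] rules out the last case of [sub_inv]. *)
Lemma component_regular a Q : Q = J a (a + 1) ->
  [set S | X S /\ crt Q S] = [set J a (a + 1)].
Proof.
move=> ->.
apply: (component_eq (P := J a (a + 1))) => [_ ->|_ S ->|_ ->|] //; last exact: rt_refl.
move=> /comparable_cases[a' [b' [-> [] /sub_inv]]] /=.
- case=> [[-> ->] //|[_ -> ->]|[e _ _]]; first by congr J; ring.
  by case: (@absurd_eq 0 _ _ (esym e)); ring.
- case=> [[-> ->] //|[_ ea eb]|[_ ea eb]].
    by rewrite -(addIr 1 eb); congr J; rewrite ea; ring.
  by case: (@absurd_eq 0 _ _ eb); rewrite ea; ring.
Qed.

Lemma component_zigzag a Q : Z a Q -> [set S | X S /\ crt Q S] = Z a.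
Proof.
apply: (component_eq (P := D a 0)) => [_ [i [] ->] //|Q' S [i [] ->]|Q' [i h]].
- move=> /comparable_cases[a' [b' [-> [h|/sub_inv]]]].
    by have [-> ->] := zig_DD h; exists i; left.
  case=> [[ea eb]|[_ ea eb]|[e ea eb]].
  + by exists i; left; rewrite -ea -eb.
  + have -> : a' = a + i%:~R - 1 by rewrite eb addrK.
    have -> : b' = a + i%:~R + 1 by rewrite ea subrK.
    by exists (i - 1); right; rewrite intrB; congr J; ring.
  + by exists i; right; rewrite e -ea.
- move=> /comparable_cases[a' [b' [-> [h|/sub_inv]]]].
    case: (zig_ED h) => ->; [by exists i; right | by exists i; left |].
    by exists (i + 1); left.
  case=> [[ea eb]|[ne ea eb]|[e ea eb]].
  + by exists i; right; rewrite -ea -eb.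
  + case/eqP: ne; apply: (addIr 1); rewrite -eb ea; ring.
  + by case: (@absurd_eq 1 _ _ eb); rewrite ea; ring.
(* Neighbouring diagonal ideals are joined through the ideal [E] below both. *)
have hD n : crt (D a 0) (D a n).
  elim/int_ind: n => [|n IH|n IH]; first exact: rt_refl.
    apply: rt_trans IH _; rewrite -addn1 PoszD.
    apply: rt_trans (crt_sub (@zig_subr a n)).
    by apply: connected_sym; apply: crt_sub; apply: zig_subl.
  apply: rt_trans IH _; apply: rt_trans (crt_sub (@zig_subl a _)).
  apply: connected_sym; apply: crt_sub.
  have := @zig_subr a (- n.+1%:Z); rewrite (_ : - n.+1%:Z + 1 = - n%:Z) //; lia.
case: h => ->; first exact: hD.
by apply: rt_trans (hD i) _; apply: connected_sym; apply: crt_sub; apply: zig_subl.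
Qed.

(** The differences [-(k + 2)] and [k] are neither [-2] nor [0], so the last case of [sub_inv]
    cannot occur and only the swap remains. *)
Lemma component_pair a (k : nat) Q : (0 < k)%N ->
  [set J (a - 1) (a + k%:R + 1); J (a + k%:R) a] Q ->
  [set S | X S /\ crt Q S] = [set J (a - 1) (a + k%:R + 1); J (a + k%:R) a].
Proof.
case: k => // k _.
apply: (component_eq (P := J (a - 1) (a + k.+1%:R + 1))) => [_ [] -> //|Q' S [] ->|Q' [] ->].
- move=> /comparable_cases[a' [b' [-> [] /sub_inv]]].
  + case=> [[-> ->]|[_ -> ->]|[e _ _]]; first by left.
      by right; congr J; ring.
    by case: (@absurd_eq k _ _ e); ring.
  + case=> [[ea eb]|[_ ea eb]|[_ ea eb]]; first by left; rewrite -ea -eb.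
      by right; rewrite (addIr 1 eb) (addIr (-1) ea).
    by case: (@absurd_eq k.+2 _ _ eb); rewrite -ea -!natr1; ring.
- move=> /comparable_cases[a' [b' [-> [] /sub_inv]]].
  + case=> [[-> ->]|[_ -> ->]|[e _ _]]; first by right.
      by left.
    by case: (@absurd_eq k.+2 _ _ (esym e)); rewrite -!natr1; ring.
  + case=> [[ea eb]|[_ ea eb]|[_ ea eb]]; first by right; rewrite -ea -eb.
      by left; rewrite ea eb; congr J; ring.
    by case: (@absurd_eq k _ _ ea); rewrite -eb; ring.
- exact: rt_refl.
- by apply: crt_sub; exact: (swap_proper _ _).1.
Qed.

(** The type is read off from [n = a - b]: not an integer; [-1]; [0] or [-2]; the remaining
    integers. *)
Lemma is_componentP (Y : set (set T)) : is_component X Y <->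
  [\/ exists a b, ~ integral (a - b) /\ Y = [set J a b; J (b - 1) (a + 1)],
      exists a, Y = [set J a (a + 1)],
      exists a, Y = Z a
    | exists a (k : nat), (0 < k)%N /\
        Y = [set J (a - 1) (a + k%:R + 1); J (a + k%:R) a]].
Proof.
split.
  move=> [_ [a [b ->]] ->].
  case: (pselect (integral (a - b))) => [[n en]|ni]; last first.
    constructor 1; exists a, b; split=> //.
    by apply: component_generic => //; left.
  have ea : a = b + n%:~R by rewrite -en addrC subrK.
  case: (eqVneq n (-1)) => [n1|n1].
    constructor 2; exists a; apply: component_regular; congr J.
    by rewrite ea n1; ring.
  case: (eqVneq n 0) => [n0|n0].
    constructor 3; exists a; apply: component_zigzag; exists 0; left.
    by congr J; rewrite ea n0; ring.
  case: (eqVneq n (-2)) => [n2|n2].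
    constructor 3; exists a; apply: component_zigzag; exists 0; right.
    by congr J; rewrite ea n2; ring.
  constructor 4; case: (lerP 0 n) => hn.
    have en' : n = (absz n)%:Z by lia.
    exists b, (absz n); have k0 : (0 < absz n)%N by lia.
    split=> //; apply: component_pair => //; right.
    by rewrite ea; congr (J (_ + _) _); rewrite [RHS]pmulrn -en'.
  (* For [n < -2] the ideal is the smaller one of its pair, with base point [a + 1] and [k = m]. *)
  pose m := (absz n - 2)%N; have en' : n = - m%:Z - 2 by rewrite /m; lia.
  exists (a + 1), m; have m0 : (0 < m)%N by rewrite /m; lia.
  split=> //; apply: component_pair => //; left.
  by rewrite ea en' intrB intrN -pmulrn; congr J; ring.
case=> [[a [b [ni ->]]]|[a ->]|[a ->]|[a [k [k0 ->]]]].
- by exists (J a b) => //; apply/esym/component_generic => //; left.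
- by exists (J a (a + 1)) => //; apply/esym/component_regular.
- by exists (D a 0) => //; apply/esym/component_zigzag; exists 0; left.
- by exists (J (a + k%:R) a) => //; apply/esym/component_pair => //; right.
Qed.

Lemma classification :
  (forall Y : set (set T), is_component X Y <->
     [\/ exists a b, ~ integral (a - b) /\ Y = [set J a b; J (b - 1) (a + 1)],
         exists a, Y = [set J a (a + 1)],
         exists a, Y = Z a
       | exists a (k : nat), (0 < k)%N /\
           Y = [set J (a - 1) (a + k%:R + 1); J (a + k%:R) a]]) /\
  (forall a b, ~ integral (a - b) -> J a b = J (b - 1) (a + 1)) /\
  (forall a, is_hasse_diagram (Z a) (edge a) /\
     [/\ injective (fun i => D a i), injective (fun i => E a i) &
         forall i j, D a i <> E a j]) /\
  (forall a (k : nat), (0 < k)%N ->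
     J (a - 1) (a + k%:R + 1) `<` J (a + k%:R) a).
Proof.
split; first exact: is_componentP.
split; first exact: swap_eq.
split; last by move=> a k _; apply: swap_proper.
move=> a; split; first exact: zig_hasse.
split=> [i j h|i j h|i j h].
- by apply: (@zig_D_inj a); rewrite h.
- by apply: (@zig_E_inj a); rewrite h.
- by apply: (@zig_DE a i j); rewrite h.
Qed.

End Classification.

(** * The four inclusion properties for annihilators in U(g) *)

Section IdealInclusions.
Context (K : numFieldType).
Implicit Types (a b : K).
Local Notation aP := (@eactP K).
Local Notation eP := (@envelP K).

Lemma J_sub_swap a b : (forall n : nat, a - b != n%:R) ->
  J a b `<=` J (b - 1) (a + 1).
Proof.
move=> h; rewrite !J_annL => u /(annL_annW eP aP h).
by rewrite (annW_swap eP aP) => /(annW_annL eP aP).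
Qed.

(** The swap of [(a, a + 2)] is [(a + 1, a + 1)], to which [annW_bottom] applies. *)
Lemma J_sub_bottom a : J a (a + 2%:R) `<=` J a a.
Proof.
have h : forall n : nat, a - (a + 2%:R) != n%:R.
  move=> n; apply/eqP => e; apply: (@absurd_eq K (n + 1) 0 0) => //.
  by rewrite subrr -natr1 natrD -e; ring.
rewrite !J_annL => u /(annL_annW eP aP h); rewrite (annW_swap eP aP).
have -> : a + 2%:R - 1 = a + 1 by ring.
by move=> /(annW_bottom eP aP); rewrite addrK.
Qed.

Lemma J_sub_inv a b a' b' : J a b `<=` J a' b' ->
  [\/ a' = a /\ b' = b, [/\ a != b, a' = b - 1 & b' = a + 1]
    | [/\ b = a + 2%:R, a' = a & b' = a] ].
Proof. by rewrite !J_annL => /(annL_sub eP aP). Qed.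

Lemma J_nsub_swap a b (n : nat) : a - b = n%:R ->
  ~ J a b `<=` J (b - 1) (a + 1).
Proof.
move=> k; rewrite !J_annL => /(_ _ (annL_pow eP aP k)).
apply: (annL_not_pow eP aP) => m; apply/eqP => e.
apply: (@absurd_eq K (n + m + 1) 0 0) => //.
by rewrite subrr -natr1 !natrD -k -e; ring.
Qed.

End IdealInclusions.

Theorem corollary6p8 (R : realType) :
  (forall Y : set (set (enveloping R[i])),
     is_component [set I | exists a b : R[i], I = J a b] Y <->
     [\/ exists a b : R[i],
           (~ exists n : int, a - b = n%:~R) /\
           Y = [set J a b; J (b - 1) (a + 1)],
         exists a : R[i], Y = [set J a (a + 1)],
         exists a : R[i], Y = zigzag a
       | exists (a : R[i]) (k : nat),
           (0 < k)%N /\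
           Y = [set J (a - 1) (a + k%:R + 1); J (a + k%:R) a]]) /\
  (forall a b : R[i], (~ exists n : int, a - b = n%:~R) ->
     J a b = J (b - 1) (a + 1)) /\
  (forall a : R[i],
     is_hasse_diagram (zigzag a) (zigzag_edge a) /\
     [/\ injective (fun i : int => J (a + i%:~R) (a + i%:~R)),
         injective (fun i : int => J (a + i%:~R) (a + i%:~R + 2)) &
         forall i j : int,
           J (a + i%:~R) (a + i%:~R) <> J (a + j%:~R) (a + j%:~R + 2)]) /\
  (forall (a : R[i]) (k : nat), (0 < k)%N ->
     J (a - 1) (a + k%:R + 1) `<` J (a + k%:R) a).
Proof.
exact: (classification (@J_sub_swap R[i]) (@J_sub_bottom R[i])
  (@J_sub_inv R[i]) (@J_nsub_swap R[i])).
Qed.
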